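(* Let $G=(V,E)$ be a graph on $n$ vertices and $k$ a positive integer. Then it can be decided in $\mathcal{O}(n^{5k+4})$ time whether $\mathrm{box}(\overline{L(G)})\le k$.
   Context: Graphs are finite and simple. The line graph $L(G)$ has vertex set $E(G)$, two distinct edges being adjacent iff they share an endpoint; $\overline{H}$ denotes the complement of $H$. The boxicity $\mathrm{box}(H)$ of a graph $H$ is the minimum $d\ge 0$ such that $H$ is the intersection graph of a family of axis-parallel boxes in $\mathbb{R}^d$ (products of $d$ closed real intervals). *)

(* Defs.v *)
From HB Require Import structures.
From mathcomp Require Import all_boot all_order all_algebra.
From mathcomp Require Import boolp classical_sets reals.

Set Implicit Arguments.
Unset Strict Implicit.
Unset Printing Implicit Defensive.

Import Order.TTheory GRing.Theory Num.Theory.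

Record sgraph (V : finType) := SGraph {
  adj :> rel V;
  adj_sym : symmetric adj;
  adj_irrefl : irreflexive adj
}.

Section Graphs.
Variable V : finType.
Implicit Type G : sgraph V.

Definition edges G : {set {set V}} :=
  [set [set p.1; p.2] | p : V * V & G p.1 p.2].

Definition edge_type G : finType := {e : {set V} | e \in edges G}.

Definition line_adj G : rel (edge_type G) :=
  fun e f => (e != f) && ~~ [disjoint val e & val f].

Lemma line_adj_sym G : symmetric (line_adj (G := G)).
Proof. by move=> e f; rewrite /line_adj eq_sym disjoint_sym. Qed.

Lemma line_adj_irrefl G : irreflexive (line_adj (G := G)).
Proof. by move=> e; rewrite /line_adj eqxx. Qed.

Definition line_graph G : sgraph (edge_type G) :=
  SGraph (@line_adj_sym G) (@line_adj_irrefl G).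

Definition compl_adj G : rel V := fun u v => (u != v) && ~~ G u v.

Lemma compl_adj_sym G : symmetric (compl_adj G).
Proof. by move=> u v; rewrite /compl_adj eq_sym adj_sym. Qed.

Lemma compl_adj_irrefl G : irreflexive (compl_adj G).
Proof. by move=> u; rewrite /compl_adj eqxx. Qed.

Definition compl_graph G : sgraph V :=
  SGraph (compl_adj_sym G) (compl_adj_irrefl G).

End Graphs.

Section Boxicity.
Local Open Scope ring_scope.
Local Open Scope classical_set_scope.
Variables (R : realType) (V : finType).

(* The intervals are nonempty. For d = 0 the only box is the whole one-point
   space, so the graphs of boxicity 0 are exactly the complete graphs. *)
Definition is_box (d : nat) (B : set 'rV[R]_d) : Prop :=
  exists a b : 'rV[R]_d, (forall i, a 0 i <= b 0 i) /\
    B = [set x : 'rV[R]_d | forall i, a 0 i <= x 0 i <= b 0 i].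

Definition box_representable (H : sgraph V) (d : nat) : Prop :=
  exists B : V -> set 'rV[R]_d,
    (forall v, is_box (B v)) /\
    (forall u v, u != v -> H u v <-> B u `&` B v !=set0).

(* One coordinate per vertex w: w gets [0, 0], its neighbours get [0, 1] and
   all other vertices get [1, 1]. *)
Lemma box_representable_card (H : sgraph V) : box_representable H #|V|.
Proof.
pose lo v : 'rV[R]_#|V| :=
  \row_i ((v != enum_val i) && ~~ H v (enum_val i))%:R.
pose hi v : 'rV[R]_#|V| := \row_i (v != enum_val i)%:R.
exists (fun v => [set x | forall i, lo v 0 i <= x 0 i <= hi v 0 i]); split.
  move=> v; exists (lo v), (hi v); split=> // i.
  by rewrite !mxE ler_nat; case: (v != _) => //=; case: (H _ _).
move=> u v neq_uv; split.
  move=> Huv; exists (\row_i ((u != enum_val i) && (v != enum_val i))%:R).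
  split=> i; rewrite !mxE !ler_nat.
    have [<-|] := eqVneq v (enum_val i); first by rewrite Huv andbF.
    by rewrite andbT => _; case: (u != _); case: (H _ _).
  have [<-|] := eqVneq u (enum_val i); first by rewrite adj_sym Huv andbF.
  by move=> _; case: (v != _); case: (H _ _).
move=> [x [/(_ (enum_rank u)) + /(_ (enum_rank u))]].
rewrite !mxE enum_rankK eqxx eq_sym neq_uv /= adj_sym.
move=> /andP[_ x_le0] /andP[+ _]; case: (H u v) => //= x_ge1.
by have := le_trans x_ge1 x_le0; rewrite ler_nat.
Qed.

Lemma box_representable_ex (H : sgraph V) :
  exists d, `[< box_representable H d >].
Proof. by exists #|V|; apply/asboolP/box_representable_card. Qed.

Definition boxicity (H : sgraph V) : nat := ex_minn (box_representable_ex H).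

End Boxicity.

(* A unit-cost random access machine. Registers, of which a program uses only
   finitely many, are addressed directly; memory cells are addressed through
   registers. The first argument of an instruction is its destination register,
   except that [IWrite x y] copies register y to the memory cell whose address
   is in register x, and [IJumpIfZero x l] jumps to l if register x is 0.
   Subtraction is truncated and division is integer division, with value 0 for
   divisor 0. The machine halts when the program counter leaves the program. *)
Inductive instr : Type :=
  | IConst of nat & nat
  | IAdd of nat & nat & nat
  | ISub of nat & nat & nat
  | IMul of nat & nat & nat
  | IDiv of nat & nat & nat
  | IRead of nat & nat
  | IWrite of nat & nat
  | IJumpIfZero of nat & nat.

Definition program := seq instr.

Record config := Config {
  pc : nat;
  reg : nat -> nat;
  cell : nat -> nat
}.

Definition upd (f : nat -> nat) (a v : nat) : nat -> nat :=
  fun b => if b == a then v else f b.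

Definition exec (i : instr) (s : config) : config :=
  let: Config l r m := s in
  match i with
  | IConst x c => Config l.+1 (upd r x c) m
  | IAdd x y z => Config l.+1 (upd r x (r y + r z)) m
  | ISub x y z => Config l.+1 (upd r x (r y - r z)) m
  | IMul x y z => Config l.+1 (upd r x (r y * r z)) m
  | IDiv x y z => Config l.+1 (upd r x (r y %/ r z)) m
  | IRead x y => Config l.+1 (upd r x (m (r y))) m
  | IWrite x y => Config l.+1 r (upd m (r x) (r y))
  | IJumpIfZero x l' => Config (if r x == 0 then l' else l.+1) r m
  end.

Definition halted (p : program) (s : config) : bool := size p <= pc s.

Definition step (p : program) (s : config) : config :=
  if onth p (pc s) is Some i then exec i s else s.

Definition run (p : program) (t : nat) (s : config) : config :=
  iter t (step p) s.

(* The input is n in register 0 and the adjacency matrix of G, row by row, in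
   the memory cells 0, ..., n * n - 1; everything else is 0. *)
Definition input (n : nat) (G : sgraph 'I_n) : config :=
  Config 0
    (fun x => if x == 0 then n else 0)
    (fun a => [exists i : 'I_n, exists j : 'I_n, (a == i * n + j) && G i j]).

Definition is_bigO (T f : nat -> nat) : Prop :=
  exists C n0, forall n, n0 <= n -> T n <= C * f n.

(* As is usual for unit-cost machines, words have O(log n) bits: all numbers
   occurring in the computation are bounded by a fixed power of n + 2. This
   prevents packing large data into a single word. The answer is returned in
   register 0. Since halted configurations do not change, the machine halts
   after at most T n steps iff it is halted at time T n. *)
Definition decidable_in_time (P : forall n, sgraph 'I_n -> Prop)
    (f : nat -> nat) : Prop :=
  exists (p : program) (T : nat -> nat) (c : nat),
    is_bigO T f /\
    forall n (G : sgraph 'I_n),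
      let s := run p (T n) (input G) in
      [/\ halted p s,
          P n G -> reg s 0 = 1,
          ~ P n G -> reg s 0 = 0
        & forall t a, reg (run p t (input G)) a <= (n + 2) ^ c /\
                      cell (run p t (input G)) a <= (n + 2) ^ c].

(* Main.v *)
Require Import Defs.
From mathcomp Require Import all_boot all_order all_algebra.
From mathcomp Require Import boolp classical_sets reals.
From mathcomp Require Import zify.

(* The boxicity of the complement of L(G) is at most k iff the edges of L(G) are
   covered by k subgraphs of L(G), each consisting of the pairs a, b with
   r a < l b for some intervals [l a, r a] on the vertices of L(G). For such a
   subgraph let e, g have the smallest right endpoints and h, f the largest left
   endpoints. If r a < l b with a distinct from e, g and b distinct from h, f,
   then {e, g, a} and {h, f, b} span a K_{3,3} in L(G), so that these six edges
   share a vertex. Hence the subgraph lies in a subgraph determined by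
   (e, g, h, f) alone, and the latter is itself given by intervals. As e and f
   meet, g meets f and h meets e, such a quadruple is described by five vertices
   and two bits. There remain (4 n^5)^k choices of k quadruples, each tested on
   the n^3 pairs of incident edges. *)

Set Implicit Arguments.
Unset Strict Implicit.
Unset Printing Implicit Defensive.

Import Order.TTheory GRing.Theory Num.Theory.

(** * Compiling straight-line code and loops *)

(** Two boxes are disjoint iff some coordinate separates them, and distinct vertices are adjacent in
    L(G) iff their boxes have to be disjoint; this is why each coordinate contributes one covering
    subgraph. Such a subgraph may be enlarged freely inside L(G) as long as it is still given by
    intervals, so only a polynomial family of large ones has to be tried, and interval systems are
    never enumerated. Two extremal edges at either end are what the argument requires: with the pair
    itself they make three edges per side, whereas K_{2,3} already occurs in L(K_4), on edges
    without a common vertex. On the machine, both the number of steps and the size of all numbers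
    have to be controlled. The search is therefore a single countdown: the digits of one number,
    polynomial in n for fixed k, encode all k quadruples and the pair under test, and the loop body
    is straight-line code whose length depends on k only. Every iteration then takes the same number
    of steps, and bounds on numbers can be read off the expressions and one loop invariant. *)

Inductive binop := OpAdd | OpSub | OpMul | OpDiv.

Definition binop_sem op : nat -> nat -> nat :=
  match op with OpAdd => addn | OpSub => subn | OpMul => muln | OpDiv => divn end.

Definition binop_instr op : nat -> nat -> nat -> instr :=
  match op with OpAdd => IAdd | OpSub => ISub | OpMul => IMul | OpDiv => IDiv end.

Inductive expr :=
  | EVar of nat
  | ECst of nat
  | EBin of binop & expr & expr
  | ECell of expr.

Fixpoint eval (r m : nat -> nat) (e : expr) : nat :=
  match e with
  | EVar x => r x
  | ECst c => c
  | EBin op e1 e2 => binop_sem op (eval r m e1) (eval r m e2)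
  | ECell e1 => m (eval r m e1)
  end.

Fixpoint vars_lt (w : nat) (e : expr) : bool :=
  match e with
  | EVar x => x < w
  | ECst _ => true
  | EBin _ e1 e2 => vars_lt w e1 && vars_lt w e2
  | ECell e1 => vars_lt w e1
  end.

(** Every intermediate result passes through a register, so the word bound has to hold for all
    subexpressions and not only for the final value. *)
Fixpoint sub_le (B : nat) (r m : nat -> nat) (e : expr) : bool :=
  (eval r m e <= B) &&
  match e with
  | EBin _ e1 e2 => sub_le B r m e1 && sub_le B r m e2
  | ECell e1 => sub_le B r m e1
  | _ => true
  end.

(** If variables are at most [b ^ D] and cells at most 1, with [b] at least 2, then every
    subexpression of [e] is at most [b ^ degree D e]. A constant [c] is below [b ^ c]; degrees add
    under products, and the successor pays for the doubling in a sum. *)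
Fixpoint degree (D : nat) (e : expr) : nat :=
  match e with
  | EVar _ => D
  | ECst c => c
  | EBin _ e1 e2 => (degree D e1 + degree D e2).+1
  | ECell e1 => degree D e1
  end.

(* The value of [e] ends up in register [d]; the registers below [d] are
   preserved. *)
Fixpoint compile (e : expr) (d : nat) : program :=
  match e with
  | EVar x => [:: IConst d 0; IAdd d x d]
  | ECst c => [:: IConst d c]
  | EBin op e1 e2 => compile e1 d ++ compile e2 d.+1 ++ [:: binop_instr op d d d.+1]
  | ECell e1 => compile e1 d ++ [:: IRead d d]
  end.

Lemma vars_ltS w e : vars_lt w e -> vars_lt w.+1 e.
Proof.
elim: e => [x /ltnW|c|op e1 IH1 e2 IH2|e1 IH1] //=.
by move=> /andP[/IH1-> /IH2->].
Qed.

Lemma eval_ext w r r' m e : vars_lt w e -> (forall x, x < w -> r x = r' x) ->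
  eval r m e = eval r' m e.
Proof.
move=> + eq_r; elim: e => [x|c|op e1 IH1 e2 IH2|e1 IH1] //=; first exact: eq_r.
  by move=> /andP[/IH1-> /IH2->].
by move=> /IH1->.
Qed.

Lemma sub_le_ext w B r r' m e : vars_lt w e ->
  (forall x, x < w -> r x = r' x) -> sub_le B r m e = sub_le B r' m e.
Proof.
move=> + eq_r; elim: e => [x|c|op e1 IH1 e2 IH2|e1 IH1] //=; first by move=> /eq_r->.
  move=> /andP[lt1 lt2].
  by rewrite (IH1 lt1) (IH2 lt2) (eval_ext _ lt1 eq_r) (eval_ext _ lt2 eq_r).
by move=> lt1; rewrite (IH1 lt1) (eval_ext _ lt1 eq_r).
Qed.

Lemma sub_leW B B' r m e : B <= B' -> sub_le B r m e -> sub_le B' r m e.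
Proof.
move=> leB; elim: e => //= [x|c|op e1 IH1 e2 IH2|e1 IH1] /andP[].
- by move=> /leq_trans->.
- by move=> /leq_trans->.
- by move=> /leq_trans-> // /andP[/IH1-> /IH2->].
- by move=> /leq_trans-> // /IH1->.
Qed.

Lemma eval_le B r m e : sub_le B r m e -> eval r m e <= B.
Proof. by case: e => //= [x|c|op e1 e2|e1] /andP[]. Qed.

Lemma binop_sem_le op b x y d1 d2 : 1 < b -> x <= b ^ d1 -> y <= b ^ d2 ->
  binop_sem op x y <= b ^ (d1 + d2).+1.
Proof.
move=> b_gt1 lex ley; have b_gt0 := ltnW b_gt1.
have le_bX i j : i <= j -> b ^ i <= b ^ j by move=> ?; rewrite leq_exp2l.
have lex' : x <= b ^ (d1 + d2) by apply/(leq_trans lex)/le_bX/leq_addr.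
have ley' : y <= b ^ (d1 + d2) by apply/(leq_trans ley)/le_bX/leq_addl.
have leXS := le_bX _ _ (leqnSn (d1 + d2)).
case: op => /=.
- rewrite expnS; apply: (@leq_trans (2 * b ^ (d1 + d2))).
    by rewrite mul2n -addnn leq_add.
  by rewrite leq_mul2r b_gt1 orbT.
- exact: leq_trans (leq_subr _ _) (leq_trans lex' leXS).
- by rewrite (leq_trans _ leXS) // expnD leq_mul.
- exact: leq_trans (leq_div _ _) (leq_trans lex' leXS).
Qed.

Lemma sub_le_degree w b D r m e : 1 < b -> vars_lt w e ->
  (forall x, x < w -> r x <= b ^ D) -> (forall a, m a <= 1) ->
  sub_le (b ^ degree D e) r m e.
Proof.
move=> b_gt1 + le_r le_m; elim: e => [x|c _|op e1 IH1 e2 IH2|e1 IH1] /=.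
- by move=> /le_r->.
- by rewrite andbT ltnW // ltn_expl.
- move=> /andP[/IH1 le1 /IH2 le2].
  rewrite binop_sem_le ?eval_le //=; apply/andP; split.
    by apply: sub_leW le1; rewrite leq_exp2l // leqW // leq_addr.
  by apply: sub_leW le2; rewrite leq_exp2l // leqW // leq_addl.
- by move=> /IH1->; rewrite (leq_trans (le_m _)) // expn_gt0 ltnW.
Qed.

(** * Executions of known length through bounded configurations *)

Definition bounded (B : nat) (s : config) : Prop :=
  forall a, reg s a <= B /\ cell s a <= B.

Definition reach (p : program) (B L : nat) (s s' : config) : Prop :=
  run p L s = s' /\ forall t, t <= L -> bounded B (run p t s).

Lemma run_add p t1 t2 s : run p (t1 + t2) s = run p t2 (run p t1 s).
Proof. by rewrite /run addnC iterD. Qed.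

Lemma reach_refl p B s : bounded B s -> reach p B 0 s s.
Proof. by move=> bs; split=> // -[]. Qed.

Lemma reach_trans p B L1 L2 s1 s2 s3 :
  reach p B L1 s1 s2 -> reach p B L2 s2 s3 -> reach p B (L1 + L2) s1 s3.
Proof.
move=> [run1 le1] [run2 le2]; split; first by rewrite run_add run1.
move=> t le_t; have [/le1//|lt_t] := leqP t L1.
rewrite -(subnKC (ltnW lt_t)) run_add run1; apply: le2.
by rewrite leq_subLR.
Qed.

Lemma reach_bounded p B L s s' : reach p B L s s' -> bounded B s'.
Proof. by case=> <-; apply. Qed.

Lemma bounded_reg B l l' r r' m : bounded B (Config l r m) ->
  (forall x, r' x <= B) -> bounded B (Config l' r' m).
Proof. by move=> le le' a; split; [exact: le' | exact: (le a).2]. Qed.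

Lemma bounded_upd B l l' r m x v : bounded B (Config l r m) -> v <= B ->
  bounded B (Config l' (upd r x v) m).
Proof.
move=> le le_v; apply: bounded_reg (le) _ => y; rewrite /upd.
by case: eqP => // _; exact: (le y).1.
Qed.

Lemma reach_step p B l i r m s' : onth p l = Some i ->
  bounded B (Config l r m) -> exec i (Config l r m) = s' -> bounded B s' ->
  reach p B 1 (Config l r m) s'.
Proof.
move=> p_l le_s exec_s le_s'.
have run1 : run p 1 (Config l r m) = s' by rewrite /run /= /step /= p_l.
by split=> // -[|[|]] // _; rewrite run1.
Qed.

Definition code_at (p : program) (l : nat) (c : program) : Prop :=
  forall i, i < size c -> onth p (l + i) = onth c i.

Lemma code_at_catl p l c1 c2 : code_at p l (c1 ++ c2) -> code_at p l c1.
Proof.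
move=> at_c i lt_i; rewrite at_c ?size_cat ?ltn_addr //.
by rewrite onth_cat lt_i.
Qed.

Lemma code_at_catr p l c1 c2 :
  code_at p l (c1 ++ c2) -> code_at p (l + size c1) c2.
Proof.
move=> at_c i lt_i; rewrite -addnA at_c ?size_cat ?ltn_add2l //.
by rewrite onth_cat ltnNge leq_addr /= addKn.
Qed.

Lemma code_at_mid c0 c1 c2 : code_at (c0 ++ c1 ++ c2) (size c0) c1.
Proof.
move=> i lt_i; rewrite onth_cat ltnNge leq_addr /= addKn.
by rewrite onth_cat lt_i.
Qed.

Lemma code_at_head p l i c : code_at p l (i :: c) -> onth p l = Some i.
Proof. by move=> /(_ 0 isT); rewrite addn0. Qed.

Lemma code_at_behead p l i c : code_at p l (i :: c) -> code_at p l.+1 c.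
Proof. by move=> /(@code_at_catr _ _ [:: i] c); rewrite addn1. Qed.

(** The registers from [d] upward act as an evaluation stack: the second operand is computed from
    [d.+1] on, so the first one survives in [d]. *)
Lemma compileP p B e d l r m :
  code_at p l (compile e d) -> vars_lt d e -> sub_le B r m e ->
  bounded B (Config l r m) ->
  exists r', [/\ reach p B (size (compile e d)) (Config l r m)
                   (Config (l + size (compile e d)) r' m),
                 r' d = eval r m e & forall x, x < d -> r' x = r x].
Proof.
elim: e d l r => [x|c|op e1 IH1 e2 IH2|e1 IH1] d l r /= at_p.
- move=> lt_x; rewrite andbT => le_x le_s.
  have upd_x v : upd r d v x = r x by rewrite /upd ltn_eqF.
  have le1 : bounded B (Config l.+1 (upd r d 0) m) by apply: bounded_upd (le_s) _.
  have le2 : bounded B (Config l.+2 (upd (upd r d 0) d (r x)) m).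
    exact: bounded_upd (le1) _.
  exists (upd (upd r d 0) d (r x)); split.
  + apply: (@reach_trans _ _ 1 1); first exact: reach_step (code_at_head at_p) _ _ le1.
    rewrite addn2; apply: reach_step (code_at_head (code_at_behead at_p)) (le1) _ le2.
    by rewrite /= upd_x /upd eqxx addn0.
  + by rewrite /upd eqxx.
  + by move=> y lt_y; rewrite /upd ltn_eqF.
- rewrite andbT => _ le_c le_s; exists (upd r d c); split.
  + apply: reach_step (code_at_head at_p) (le_s) _ _; first by rewrite /= addn1.
    exact: bounded_upd (le_s) _.
  + by rewrite /upd eqxx.
  + by move=> y lt_y; rewrite /upd ltn_eqF.
- move=> /andP[lt1 lt2] /and3P[le_op le1 le2] le_s.
  have [r1 [reach1 r1_d r1_lt]] := IH1 _ _ _ (code_at_catl at_p) lt1 le1 le_s.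
  have at_p2 := code_at_catr at_p; have at_p3 := code_at_catr at_p2.
  have le2' : sub_le B r1 m e2 by rewrite (sub_le_ext _ _ lt2 r1_lt).
  have [r2 [reach2 r2_d r2_lt]] := IH2 _ _ _ (code_at_catl at_p2) (vars_ltS lt2)
    le2' (reach_bounded reach1).
  set v := binop_sem _ _ _.
  exists (upd r2 d v); split.
  + rewrite !size_cat; apply: reach_trans (reach1) _; apply: reach_trans (reach2) _.
    apply: reach_step (code_at_head at_p3) (reach_bounded reach2) _ _.
      have -> : v = binop_sem op (r2 d) (r2 d.+1).
        by rewrite r2_d (r2_lt d) // r1_d (eval_ext _ lt2 r1_lt).
      by rewrite /= addn1 !addnS !addnA; case: (op).
    exact: bounded_upd (reach_bounded reach2) _.
  + by rewrite /upd eqxx.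
  + by move=> y lt_y; rewrite /upd ltn_eqF // r2_lt ?leqW ?r1_lt.
- move=> lt1 /andP[le_v le1] le_s.
  have [r1 [reach1 r1_d r1_lt]] := IH1 _ _ _ (code_at_catl at_p) lt1 le1 le_s.
  exists (upd r1 d (m (eval r m e1))); split.
  + rewrite size_cat; apply: reach_trans (reach1) _.
    apply: reach_step (code_at_head (code_at_catr at_p)) (reach_bounded reach1) _ _.
      by rewrite /= r1_d addn1 addnS.
    exact: bounded_upd (reach_bounded reach1) _.
  + by rewrite /upd eqxx.
  + by move=> y lt_y; rewrite /upd ltn_eqF // r1_lt.
Qed.

(** * Sequences of assignments and a countdown loop *)

Definition block := seq (nat * expr).

Fixpoint eval_block (m r : nat -> nat) (b : block) : nat -> nat :=
  if b is (x, e) :: b' then eval_block m (upd r x (eval r m e)) b' else r.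

Fixpoint block_lt (w : nat) (b : block) : bool :=
  if b is (x, e) :: b' then [&& x < w, vars_lt w e & block_lt w b'] else true.

Fixpoint block_le (B : nat) (m r : nat -> nat) (b : block) : bool :=
  if b is (x, e) :: b' then
    sub_le B r m e && block_le B m (upd r x (eval r m e)) b'
  else true.

(* Registers below [w] hold the variables, the others are scratch. *)
Fixpoint compile_block (w : nat) (b : block) : program :=
  if b is (x, e) :: b' then
    compile e w ++ [:: IConst w.+1 0; IAdd x w w.+1] ++ compile_block w b'
  else [::].

(** The valuation [v] is the ideal one; the registers [r] agree with it only below [w], because
    scratch registers keep leftovers of earlier evaluations. *)
Lemma compile_blockP p B w b l r v m :
  code_at p l (compile_block w b) -> block_lt w b -> block_le B m v b ->
  (forall x, x < w -> r x = v x) -> bounded B (Config l r m) ->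
  exists r', reach p B (size (compile_block w b)) (Config l r m)
               (Config (l + size (compile_block w b)) r' m) /\
             forall x, x < w -> r' x = eval_block m v b x.
Proof.
elim: b l r v => [|[x e] b IH] l r v /=.
  by move=> _ _ _ eq_r le_s; exists r; split=> //; rewrite addn0; apply: reach_refl.
move=> at_p /and3P[lt_x lt_e lt_b] /andP[le_e le_b] eq_r le_s.
have le_e' : sub_le B r m e by rewrite (sub_le_ext _ _ lt_e eq_r).
have [r1 [reach1 r1_w r1_lt]] := compileP (code_at_catl at_p) lt_e le_e' le_s.
rewrite (eval_ext _ lt_e eq_r) in r1_w.
have at_p2 := code_at_catr at_p.
have le1 := reach_bounded reach1.
set l1 := (_ + _) in at_p2 reach1 le1.
set u := eval v m e in le_b r1_w *.
have le2 : bounded B (Config l1.+1 (upd r1 w.+1 0) m) by apply: bounded_upd (le1) _.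
have le3 : bounded B (Config l1.+2 (upd (upd r1 w.+1 0) x u) m).
  by apply: bounded_upd (le2) _; apply: eval_le.
have step2 : reach p B 1 (Config l1 r1 m) (Config l1.+1 (upd r1 w.+1 0) m).
  exact: reach_step (code_at_head at_p2) _ _ le2.
have step3 : reach p B 1 (Config l1.+1 (upd r1 w.+1 0) m)
    (Config l1.+2 (upd (upd r1 w.+1 0) x u) m).
  apply: reach_step (code_at_head (code_at_behead at_p2)) (le2) _ le3.
  by rewrite /= /upd eqxx addn0 ltn_eqF // r1_w.
have eq_r3 y : y < w -> upd (upd r1 w.+1 0) x u y = upd v x u y.
  move=> lt_y; rewrite /upd; case: eqP => // _.
  by rewrite ltn_eqF ?ltnS 1?ltnW // r1_lt // eq_r.
have [|r4 [reach4 r4_lt]] := IH l1.+2 _ _ _ lt_b le_b eq_r3 le3.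
  exact: code_at_behead (code_at_behead at_p2).
exists r4; split=> //.
rewrite size_cat /= -add2n; apply: reach_trans (reach1) _.
apply: (@reach_trans _ _ 2); first exact: (@reach_trans _ _ 1 1) step2 step3.
by rewrite addnA addnA addn2 in reach4 *.
Qed.

Section Loop.
Variables (w : nat) (init body fin : block).

Definition loop_head := size (compile_block w init).

(** The 3 counts the exit test and the jump back, which consists of loading 0 and testing it. *)
Definition loop_exit := loop_head + (size (compile_block w body) + 3).

(* Register 1 is the loop counter. *)
Definition loop_program : program :=
  compile_block w init ++
  (IJumpIfZero 1 loop_exit :: compile_block w body ++
    [:: IConst w 0; IJumpIfZero w loop_head]) ++
  compile_block w fin.

Variables (B : nat) (m : nat -> nat) (Inv : nat -> (nat -> nat) -> Prop).
Hypotheses (w_gt1 : 1 < w) (body_lt : block_lt w body).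
Hypothesis Inv_counter : forall j v, Inv j v -> v 1 = j.
Hypothesis Inv_le : forall j v, Inv j.+1 v -> block_le B m v body.
Hypothesis Inv_step : forall j v, Inv j.+1 v -> Inv j (eval_block m v body).

(** The invariant is indexed by the value of the counter, so induction on [j] is induction on the
    remaining iterations. The final successor in the number of steps is the exit test at counter
    0. *)
Lemma loopP j v r : Inv j v -> (forall x, x < w -> r x = v x) ->
  bounded B (Config loop_head r m) ->
  exists v' r', [/\ reach loop_program B (j * (size (compile_block w body) + 3)).+1
                      (Config loop_head r m) (Config loop_exit r' m),
                    Inv 0 v' & forall x, x < w -> r' x = v' x].
Proof.
have := @code_at_mid (compile_block w init) (IJumpIfZero 1 loop_exit ::
  compile_block w body ++ [:: IConst w 0; IJumpIfZero w loop_head])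
  (compile_block w fin).
rewrite -/loop_program -/loop_head => at_p.
have at_b := code_at_behead at_p; have at_j := code_at_catr at_b.
elim: j v r => [|j IH] v r inv_v eq_r le_s.
  exists v, r; split=> //; apply: reach_step (code_at_head at_p) (le_s) _ _.
    by rewrite /= eq_r // (Inv_counter inv_v).
  exact: bounded_reg le_s (fun x => (le_s x).1).
have le1 : bounded B (Config loop_head.+1 r m).
  exact: bounded_reg le_s (fun x => (le_s x).1).
have step1 : reach loop_program B 1 (Config loop_head r m) (Config loop_head.+1 r m).
  by apply: reach_step (code_at_head at_p) (le_s) _ le1; rewrite /= eq_r // (Inv_counter inv_v).
have [r2 [reach2 eq_r2]] := compile_blockP (code_at_catl at_b) body_lt
  (Inv_le inv_v) eq_r le1.
have le2 := reach_bounded reach2.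
set l2 := (_ + _) in at_j reach2 le2.
have le3 : bounded B (Config l2.+1 (upd r2 w 0) m) by apply: bounded_upd (le2) _.
have le4 : bounded B (Config loop_head (upd r2 w 0) m) by apply: bounded_upd (le2) _.
have step3 : reach loop_program B 1 (Config l2 r2 m) (Config l2.+1 (upd r2 w 0) m).
  exact: reach_step (code_at_head at_j) (le2) _ le3.
have step4 : reach loop_program B 1 (Config l2.+1 (upd r2 w 0) m)
    (Config loop_head (upd r2 w 0) m).
  apply: reach_step (code_at_head (code_at_behead at_j)) (le3) _ le4.
  by rewrite /= {1}/upd eqxx.
have eq_r4 x : x < w -> upd r2 w 0 x = eval_block m v body x.
  by move=> lt_x; rewrite /upd ltn_eqF // eq_r2.
have [v' [r' [reach5 inv_v' eq_r']]] := IH _ _ (Inv_step inv_v) eq_r4 le4.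
exists v', r'; split=> //.
have := reach_trans step1 (reach_trans reach2 (reach_trans step3
  (reach_trans step4 reach5))).
by congr reach; lia.
Qed.

Hypotheses (init_lt : block_lt w init) (fin_lt : block_lt w fin).

Lemma loop_programP N (r : nat -> nat) : block_le B m r init ->
  (forall v, Inv 0 v -> block_le B m v fin) ->
  Inv N (eval_block m r init) -> bounded B (Config 0 r m) ->
  let L := loop_head + (N * (size (compile_block w body) + 3)).+1
           + size (compile_block w fin) in
  exists v s', [/\ reach loop_program B L (Config 0 r m) s',
    halted loop_program s', Inv 0 v &
    forall x, x < w -> reg s' x = eval_block m v fin x].
Proof.
move=> le_init le_fin inv_N le_s L.
have [|r1 [reach1 eq_r1]] :=
    compile_blockP (p := loop_program) _ init_lt le_init (fun x _ => erefl) le_s.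
  exact: (@code_at_mid [::] (compile_block w init)).
rewrite add0n -/loop_head in reach1.
have [v [r2 [reach2 inv_v eq_r2]]] := loopP inv_N eq_r1 (reach_bounded reach1).
have at_fin : code_at loop_program loop_exit (compile_block w fin).
  have := @code_at_mid (compile_block w init ++ (IJumpIfZero 1 loop_exit ::
    compile_block w body ++ [:: IConst w 0; IJumpIfZero w loop_head]))
    (compile_block w fin) [::].
  rewrite cats0 -catA -/loop_program; congr code_at.
  by rewrite size_cat /= size_cat /= /loop_exit /loop_head; lia.
have [r3 [reach3 eq_r3]] :=
  compile_blockP at_fin fin_lt (le_fin _ inv_v) eq_r2 (reach_bounded reach2).
exists v, (Config (loop_exit + size (compile_block w fin)) r3 m); split=> //.
  exact: reach_trans (reach_trans reach1 reach2) reach3.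
rewrite /halted /= /loop_program !size_cat /= size_cat /= /loop_exit /loop_head.
lia.
Qed.

End Loop.

Lemma run_halted p s t : halted p s -> run p t s = s.
Proof.
move=> halt_s; elim: t => // t IH; rewrite /run iterS -/(run p t s) IH.
by rewrite /step; move: halt_s; rewrite /halted -onthNE; case: onth.
Qed.

(** * Covering subgraphs of the line graph *)

Section PairSystem.
Variable T : eqType.
Implicit Types a b e f g h : T * T.

Definition same_pair a b : bool :=
  (a.1 == b.1) && (a.2 == b.2) || (a.1 == b.2) && (a.2 == b.1).

Definition on_pair (u : T) a : bool := (u == a.1) || (u == a.2).

Definition adj_pair a b : bool :=
  ~~ same_pair a b && (on_pair a.1 b || on_pair a.2 b).

(** Meant for adjacent [a] and [b]. As e has the smallest right endpoint and f the largest left one,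
    every edge adjacent to e or f may be separated from it. What lies to the right of g also lies to
    the right of e, hence the clauses for g, and dually those for h. The last clause is the star
    that K_{3,3} produces. Edges are ordered pairs here so that the definition also applies to the
    numbers handled by the program. *)
Definition covered (u : T) e g h f a b : bool :=
  [&& adj_pair e h, adj_pair e f, adj_pair g h, adj_pair g f &
   [|| same_pair a e, same_pair b e, same_pair a f, same_pair b f,
       same_pair a g && adj_pair b e, same_pair b g && adj_pair a e,
       same_pair a h && adj_pair b f, same_pair b h && adj_pair a f |
       [&& on_pair u a, on_pair u b, on_pair u g & on_pair u h]]].

End PairSystem.

Lemma same_pairE (V : finType) (a b : V * V) :
  same_pair a b = ([set a.1; a.2] == [set b.1; b.2]).
Proof.
apply/idP/eqP => [|eq_ab]; rewrite /same_pair.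
  by case/orP=> /andP[/eqP-> /eqP->] //; rewrite finset.setUC.
have /set2P a1b : a.1 \in [set b.1; b.2] by rewrite -eq_ab set21.
have /set2P a2b : a.2 \in [set b.1; b.2] by rewrite -eq_ab set22.
have /set2P b1a : b.1 \in [set a.1; a.2] by rewrite eq_ab set21.
have /set2P b2a : b.2 \in [set a.1; a.2] by rewrite eq_ab set22.
case: a1b b1a b2a a2b => -> [] -> [] -> [] ->; rewrite !eqxx ?orbT //.
Qed.

Lemma on_pairE (V : finType) u (a : V * V) : on_pair u a = (u \in [set a.1; a.2]).
Proof. by rewrite !inE. Qed.

Lemma adj_pairE (V : finType) (a b : V * V) :
  adj_pair a b = ([set a.1; a.2] != [set b.1; b.2]) &&
                 ~~ [disjoint [set a.1; a.2] & [set b.1; b.2]].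
Proof.
rewrite /adj_pair same_pairE; congr (_ && _).
rewrite !on_pairE; apply/orP/pred0Pn => [[u_b|u_b]|[u /andP[]]].
- by exists a.1; rewrite /= u_b set21.
- by exists a.2; rewrite /= u_b set22.
by rewrite /= => /set2P[]-> ->; [left|right].
Qed.

Section Sets.
Variable V : finType.
Implicit Types a b e f g h : {set V}.

Definition sadj a b := (a != b) && ~~ [disjoint a & b].

Definition scovered (u : V) e g h f a b : bool :=
  [&& sadj e h, sadj e f, sadj g h, sadj g f &
   [|| a == e, b == e, a == f, b == f,
       (a == g) && sadj b e, (b == g) && sadj a e,
       (a == h) && sadj b f, (b == h) && sadj a f |
       [&& u \in a, u \in b, u \in g & u \in h]]].

Lemma covered_set u (e g h f a b : V * V) :
  covered u e g h f a b =
  scovered u [set e.1; e.2] [set g.1; g.2] [set h.1; h.2] [set f.1; f.2]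
    [set a.1; a.2] [set b.1; b.2].
Proof. by rewrite /covered !same_pairE !adj_pairE !on_pairE. Qed.

Lemma sadj_sym a b : sadj a b = sadj b a.
Proof. by rewrite /sadj eq_sym disjoint_sym. Qed.

Lemma scovered_sym u e g h f a b :
  scovered u e g h f a b = scovered u e g h f b a.
Proof.
rewrite /scovered; do 4!congr (_ && _).
by do 4!(rewrite orbCA; congr (_ || (_ || _))); rewrite andbCA.
Qed.

Lemma sadj_common u a b : a != b -> u \in a -> u \in b -> sadj a b.
Proof.
by move=> neq ua ub; rewrite /sadj neq; apply/pred0Pn; exists u; rewrite /= ua.
Qed.

(** * Intervals for the subgraph of a quadruple *)

Section Representation.
Variables (u : V) (e g h f : {set V}).
Hypotheses (eh : sadj e h) (ef : sadj e f) (gh : sadj g h) (gf : sadj g f).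
Hypotheses (ue : u \in e) (uf : u \in f).

Let M := #|{: {set V}}|.
Let rk (a : {set V}) : nat := enum_rank a.

Let rk_lt a : rk a < M. Proof. exact: ltn_ord. Qed.

Let rk_inj a b : a != b -> rk a != rk b.
Proof. by rewrite (inj_eq val_inj) (inj_eq enum_rank_inj). Qed.

(** If g and h pass through [u] as e and f do, every further edge at [u] is adjacent to all four and
    can be placed between them as a single point. If g or h misses [u], the star is empty. *)
Definition star a : bool :=
  [&& u \in g, u \in h, u \in a & a \notin [:: e; g; h; f]].

(* From left to right: e ends at 1 and g at 2, then come the edges of the star
   at u in the order [rk], and h starts at M + 5 and f at M + 6. The other edges
   extend just far enough to meet those of e, g, h, f they are not adjacent to. *)
Definition rgt a : nat :=
  if a == e then 1 else if a == g then 2 else if star a then 3 + rk a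
  else if ~~ sadj a f then M + 6 else if ~~ sadj a h then M + 5 else M + 4.

Definition lft a : nat :=
  if a == f then M + 6 else if a == h then M + 5 else if star a then 3 + rk a
  else if ~~ sadj a e then 1 else if ~~ sadj a g then 2 else 3.

Let sadj_neq a b : sadj a b -> a != b. Proof. by case/andP. Qed.

Lemma star_sadj a b : star a -> u \in b -> b \in [:: e; g; h; f] -> sadj a b.
Proof.
case/and4P=> _ _ ua a_out ub b_in; apply: (@sadj_common u) => //.
by apply: contraNneq a_out => ->.
Qed.

Lemma star_e a : star a -> sadj a e.
Proof. by move/star_sadj; apply=> //; rewrite !inE eqxx. Qed.

Lemma star_g a : star a -> sadj a g.
Proof. by move=> sa; apply: (star_sadj sa); rewrite ?inE ?eqxx ?orbT //; case/andP: sa. Qed.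

Lemma star_h a : star a -> sadj a h.
Proof. by move=> sa; apply: (star_sadj sa); rewrite ?inE ?eqxx ?orbT //; case/and3P: sa. Qed.

Lemma star_f a : star a -> sadj a f.
Proof. by move/star_sadj; apply=> //; rewrite !inE eqxx !orbT. Qed.

Lemma star_star a b : star a -> star b -> rk a != rk b -> sadj a b.
Proof.
case/and4P=> _ _ ua _ /and4P[_ _ ub _] neq_ab; apply: (@sadj_common u) => //.
by apply: contraNneq neq_ab => ->.
Qed.

(** Star points lie between 3 and M + 2, since ranks are below M, and all edges other than e, g and
    the star end at M + 4 or later. Hence only e, g and star edges can end before a left endpoint
    that belongs to neither h nor f. *)
Lemma rgt_lft_sadj a b : rgt a < lft b -> sadj a b.
Proof.
have ra := rk_lt a; have rb := rk_lt b.
rewrite /lft; case: eqP => [->|_]; last case: eqP => [->|_];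
  last case: ifP => [sb|_]; last case: ifPn => [_|/negPn be];
  last case: ifPn => [_|/negPn bg].
- rewrite /rgt; case: eqP => [-> //|_]; case: eqP => [-> //|_].
  case: ifP => [/star_f //|_]; case: ifPn => [_|/negPn //]; lia.
- rewrite /rgt; case: eqP => [-> //|_]; case: eqP => [-> //|_].
  case: ifP => [/star_h //|_]; case: ifPn => _; first lia.
  case: ifPn => [_|/negPn //]; lia.
- rewrite /rgt; case: eqP => [-> _|_]; first by rewrite sadj_sym star_e.
  case: eqP => [-> _|_]; first by rewrite sadj_sym star_g.
  case: ifP => [sa lt_ab|_]; first by apply: star_star => //; lia.
  by do ?[case: ifP => _]; lia.
- by rewrite /rgt; do ?[case: ifP => _]; lia.
- rewrite /rgt; case: eqP => [-> _|_]; first by rewrite sadj_sym.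
  by do ?[case: ifP => _]; lia.
- rewrite /rgt; case: eqP => [-> _|_]; first by rewrite sadj_sym.
  case: eqP => [-> _|_]; first by rewrite sadj_sym.
  by do ?[case: ifP => _]; lia.
Qed.

(** An inverted interval would, by [rgt_lft_sadj], make [a] adjacent to itself. *)
Lemma lft_le_rgt a : lft a <= rgt a.
Proof.
by rewrite leqNgt; apply/negP => /rgt_lft_sadj /sadj_neq /eqP.
Qed.

Lemma rgt_e a : sadj a e -> rgt e < lft a.
Proof.
have rb := rk_lt a.
by rewrite /rgt eqxx /lft => ->; do ?[case: ifP => _]; lia.
Qed.

Lemma lft_f a : sadj a f -> rgt a < lft f.
Proof.
have ra := rk_lt a.
by rewrite /lft eqxx /rgt => ->; do ?[case: ifP => _]; lia.
Qed.

Lemma rgt_g a : sadj a g -> sadj a e -> rgt g < lft a.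
Proof.
have rb := rk_lt a.
rewrite /rgt eqxx /lft => -> ->.
by case: (g == e); do ?[case: ifP => _]; lia.
Qed.

Lemma lft_h a : sadj a h -> sadj a f -> rgt a < lft h.
Proof.
have rb := rk_lt a.
rewrite /lft eqxx /rgt => -> ->.
by case: (h == f); do ?[case: ifP => _]; lia.
Qed.

Lemma rgt_lft_star a b : star a -> star b -> rk a < rk b -> rgt a < lft b.
Proof.
move=> sa sb lt_ab; rewrite /rgt /lft sa sb.
case/and4P: sa => _ _ _; case/and4P: sb => _ _ _.
rewrite !inE !negb_or => /and4P[_ _ /negPf-> /negPf->] /and4P[/negPf-> /negPf-> _ _].
lia.
Qed.

Lemma covered_rgt_lft a b : sadj a b -> scovered u e g h f a b ->
  rgt a < lft b \/ rgt b < lft a.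
Proof.
move=> ab /and5P[_ _ _ _ cov]; have ba : sadj b a by rewrite sadj_sym.
have [ae|ae] := eqVneq a e; first by rewrite ae in ba *; left; apply: rgt_e.
have [be|be] := eqVneq b e; first by rewrite be in ab *; right; apply: rgt_e.
have [af|af] := eqVneq a f; first by rewrite af in ba *; right; apply: lft_f.
have [bf|bf] := eqVneq b f; first by rewrite bf in ab *; left; apply: lft_f.
move: cov; rewrite (negPf ae) (negPf be) (negPf af) (negPf bf) !orFb.
(* In the last clause, an edge at [u] other than e and f is g, h or a star edge; two star edges are
   separated by their ranks. *)
have star_or (c : {set V}) : u \in c -> u \in g -> u \in h -> c != e -> c != f ->
    [\/ c = g, c = h | star c].
  move=> uc ug uh /negPf ce /negPf cf.
  rewrite /star uc ug uh !inE ce cf /= orbF.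
  by case: eqP => [|_]; [constructor 1|case: eqP; [constructor 2|constructor 3]].
have adj_e (c : {set V}) : u \in c -> c != e -> sadj c e by move=> uc ce; exact: sadj_common ce uc ue.
have adj_f (c : {set V}) : u \in c -> c != f -> sadj c f by move=> uc cf; exact: sadj_common cf uc uf.
case/or4P=> [/andP[/eqP ag ?]|/andP[/eqP bg ?]|/andP[/eqP ah ?]|/orP[/andP[/eqP bh ?]|]].
- by rewrite ag in ba *; left; apply: rgt_g.
- by rewrite bg in ab *; right; apply: rgt_g.
- by rewrite ah in ba *; right; apply: lft_h.
- by rewrite bh in ab *; left; apply: lft_h.
case/and4P=> ua ub ug uh.
case: (star_or a ua ug uh ae af) => [ag|ah|sa].
- by rewrite ag in ba *; left; apply: rgt_g => //; apply: adj_e.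
- by rewrite ah in ba *; right; apply: lft_h => //; apply: adj_f.
case: (star_or b ub ug uh be bf) => [bg|bh|sb].
- by rewrite bg in ab *; right; apply: rgt_g => //; apply: adj_e.
- by rewrite bh in ab *; left; apply: lft_h => //; apply: adj_f.
have := rk_inj (sadj_neq ab); rewrite neq_ltn => /orP[lt_ab|lt_ba].
- by left; apply: rgt_lft_star.
- by right; apply: rgt_lft_star.
Qed.

End Representation.

(** * Copies of K_{3,3} in a line graph *)

Lemma pair_set_eq p q a : #|a| = 2 -> p \in a -> q \in a -> p != q ->
  a = [set p; q].
Proof.
move=> card_a pa qa neq_pq; apply/eqP; rewrite eq_sym eqEcard.
by rewrite finset.subUset !finset.sub1set pa qa cards2 neq_pq card_a.
Qed.

Lemma pair_setP p a : #|a| = 2 -> p \in a -> exists2 q, p != q & a = [set p; q].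
Proof.
move/eqP/cards2P=> [q [r [neq_qr ->]]] /set2P[]->; first by exists r.
by exists q; rewrite 1?eq_sym // finset.setUC.
Qed.

Lemma sadj_meet p q a : sadj [set p; q] a -> p \notin a -> q \in a.
Proof. by case/andP=> _ /pred0Pn[r /andP[/set2P[]-> /= ->]]. Qed.

(** If [u] misses [a2], then a1 = uv, b1 = uz and a2 = zx form a triangle or a path, and b2, b3 both
    have to meet a1 as well as a2. In either case the few possibilities for b2 and b3 leave no room
    for a3. *)
Lemma K33_common u a1 a2 a3 b1 b2 b3 :
  {in [:: a1; a2; a3; b1; b2; b3], forall a, #|a| = 2} ->
  uniq [:: a1; a2; a3] -> uniq [:: b1; b2; b3] ->
  {in [:: a1; a2; a3] & [:: b1; b2; b3], forall a b, sadj a b} ->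
  u \in a1 -> u \in b1 -> u \in a2.
Proof.
move=> card_2 uniq_a uniq_b adj ua1 ub1; apply: contraT => ua2.
have card a : a \in [:: a1; a2; a3; b1; b2; b3] -> #|a| = 2 by exact: card_2.
have [v uv a1E] : exists2 v, u != v & a1 = [set u; v].
  by apply: pair_setP => //; apply: card; rewrite !inE eqxx.
have [z uz b1E] : exists2 z, u != z & b1 = [set u; z].
  by apply: pair_setP => //; apply: card; rewrite !inE eqxx !orbT.
have za2 : z \in a2.
  have : sadj b1 a2 by rewrite sadj_sym; apply: adj; rewrite !inE eqxx ?orbT.
  by rewrite b1E => /sadj_meet; apply.
have [x zx a2E] : exists2 x, z != x & a2 = [set z; x].
  by apply: pair_setP => //; apply: card; rewrite !inE eqxx ?orbT.
have vz : v != z.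
  have /andP[+ _] : sadj a1 b1 by apply: adj; rewrite !inE eqxx ?orbT.
  by apply: contraNneq => vz; rewrite a1E b1E vz.
have ux : u != x by move: ua2; rewrite a2E !inE negb_or => /andP[].
have := uniq_a; rewrite /= !inE negb_or andbT => /andP[/andP[a12 a13] a23].
have := uniq_b; rewrite /= !inE negb_or andbT => /andP[/andP[b12 b13] b23].
have card_a3 : #|a3| = 2 by apply: card; rewrite !inE eqxx ?orbT.
have a3b1 : sadj b1 a3 by rewrite sadj_sym; apply: adj; rewrite !inE eqxx ?orbT.
have uv_a3 : u \in a3 -> v \notin a3.
  by move=> ua3; apply: contraNN a13 => va3; rewrite (pair_set_eq card_a3 ua3 va3) // a1E.
have uz_a3 : u \in a3 -> z \notin a3.
  move=> ua3; move: a3b1; rewrite /sadj => /andP[+ _].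
  by apply: contraNN => za3; rewrite (pair_set_eq card_a3 ua3 za3) // b1E.
have zx_a3 : z \in a3 -> x \notin a3.
  by move=> za3; apply: contraNN a23 => xa3; rewrite (pair_set_eq card_a3 za3 xa3) // a2E.
have Hb b : b \in [:: b2; b3] ->
    [/\ #|b| = 2, sadj b a3, u \in b -> z \notin b & u \in b -> v \notin b] /\
    [/\ z \in b -> x \notin b, u \notin b -> v \in b & z \notin b -> x \in b].
  move=> b_in.
  have b_in' : b \in [:: b1; b2; b3] by rewrite inE b_in orbT.
  have card_b : #|b| = 2 by apply: card; move: b_in'; rewrite !inE => /or3P[]->; rewrite !orbT.
  have b1b : b1 != b by move: b_in; rewrite !inE => /orP[]/eqP->.
  have a1b : sadj a1 b by apply: adj => //; rewrite !inE eqxx ?orbT.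
  have a2b : sadj a2 b by apply: adj => //; rewrite !inE eqxx ?orbT.
  have a3b : sadj a3 b by apply: adj => //; rewrite !inE eqxx ?orbT.
  do 2!split=> //; first by rewrite sadj_sym.
  - by move=> ub; apply: contraNN b1b => zb; rewrite (pair_set_eq card_b ub zb) // b1E.
  - move=> ub; case/andP: a1b => + _.
    by apply: contraNN => vb; rewrite (pair_set_eq card_b ub vb) // a1E.
  - move=> zb; case/andP: a2b => + _.
    by apply: contraNN => xb; rewrite (pair_set_eq card_b zb xb) // a2E.
  - by apply: sadj_meet; rewrite -a1E.
  - by apply: sadj_meet; rewrite -a2E.
have [[card2 adj2 uz2 uv2] [zx2 u2 z2]] := Hb b2 (mem_head _ _).
have [[card3 adj3 uz3 uv3] [zx3 u3 z3]] := Hb b3 (mem_last b2 [:: b3]).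
have v_b b : (u \in b -> z \notin b) -> (u \notin b -> v \in b) ->
  (z \notin b -> x \in b) -> v = x -> v \in b.
  move=> uzb ub zb vx; have [/uzb/zb|/ub//] := boolP (u \in b).
  by rewrite vx.
(* Triangle: an edge other than b1 meeting both uv and zv contains v. So a3, which avoids v, joins
   the other ends of b2 and b3, and neither of these lies on b1. *)
have [vx|vx] := eqVneq v x.
  have vb2 : v \in b2 by apply: v_b.
  have vb3 : v \in b3 by apply: v_b.
  have va3 : v \notin a3.
    have [/uv_a3//|ua3] := boolP (u \in a3).
    by rewrite vx zx_a3 //; apply: sadj_meet ua3; rewrite -b1E.
  have [y2 vy2 b2E] := pair_setP card2 vb2; have [y3 vy3 b3E] := pair_setP card3 vb3.
  have y2a3 : y2 \in a3 by apply: sadj_meet va3; rewrite -b2E.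
  have y3a3 : y3 \in a3 by apply: sadj_meet va3; rewrite -b3E.
  have y23 : y2 != y3 by apply: contraNneq b23 => y23; rewrite b2E b3E y23.
  have a3E := pair_set_eq card_a3 y2a3 y3a3 y23.
  have out b y : v \in b -> b = [set v; y] -> (u \in b -> v \notin b) ->
      (z \in b -> x \notin b) -> (u != y) && (z != y).
    move=> vb bE uvb zxb; apply/andP; split.
      by apply: contraTneq vb => uy; apply: uvb; rewrite bE uy set22.
    by apply: contraTneq vb => zy; rewrite vx; apply: zxb; rewrite bE zy set22.
  have /andP[uy2 zy2] := out _ _ vb2 b2E uv2 zx2.
  have /andP[uy3 zy3] := out _ _ vb3 b3E uv3 zx3.
  have : z \in a3 by apply: (sadj_meet (p := u)); rewrite -?b1E // a3E !inE negb_or uy2.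
  by rewrite a3E !inE (negPf zy2) (negPf zy3).
(* An edge that meets both end edges of the path v, u, z, x and is none of its three edges is ux, vz
   or vx. *)
have inx b : #|b| = 2 -> (u \in b -> z \notin b) -> (u \in b -> v \notin b) ->
    (z \in b -> x \notin b) -> (u \notin b -> v \in b) -> (z \notin b -> x \in b) ->
    [\/ b = [set u; x], b = [set v; z] | b = [set v; x]].
  move=> cb uzb uvb zxb ub zb.
  have [inu|/ub inv] := boolP (u \in b).
    by constructor 1; apply: pair_set_eq => //; apply/zb/uzb.
  have [inz|/zb inx] := boolP (z \in b).
    by constructor 2; apply: pair_set_eq.
  by constructor 3; apply: pair_set_eq.
have {}inx2 := inx b2 card2 uz2 uv2 zx2 u2 z2.
have {}inx3 := inx b3 card3 uz3 uv3 zx3 u3 z3.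
(* The edge a3 contains exactly one end of b1. If it is u, then vz is ruled out, so one of b2, b3 is
   ux and the other vx, and these disagree on whether x lies on a3. If it is z, then ux is ruled
   out, and vz and vx disagree about v. *)
have [ua3|ua3] := boolP (u \in a3).
  have va3 := uv_a3 ua3; have za3 := uz_a3 ua3.
  have nvz b : sadj b a3 -> b <> [set v; z].
    by move=> + bE; rewrite bE => /sadj_meet/(_ va3); rewrite (negPf za3).
  have nvx b : sadj b a3 -> b = [set v; x] -> x \in a3.
    by move=> + bE; rewrite bE => /sadj_meet/(_ va3).
  have xux b : sadj b a3 -> b = [set u; x] -> x \notin a3.
    move=> /andP[+ _] bE; rewrite bE; apply: contraNN => xa3.
    by rewrite [a3](pair_set_eq card_a3 ua3 xa3).
  case: inx2 inx3 => [E2|/(nvz _ adj2)//|E2] [E3|/(nvz _ adj3)//|E3];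
    try by rewrite E2 E3 eqxx in b23.
  - by move: (xux _ adj2 E2); rewrite (nvx _ adj3 E3).
  - by move: (xux _ adj3 E3); rewrite (nvx _ adj2 E2).
have za3 : z \in a3 by apply: sadj_meet ua3; rewrite -b1E.
have xa3 := zx_a3 za3.
have nux b : sadj b a3 -> b <> [set u; x].
  by move=> + bE; rewrite bE => /sadj_meet/(_ ua3); rewrite (negPf xa3).
have nvx b : sadj b a3 -> b = [set v; x] -> v \in a3.
  by move=> + bE; rewrite bE finset.setUC => /sadj_meet/(_ xa3).
have nvz b : sadj b a3 -> b = [set v; z] -> v \notin a3.
  move=> /andP[+ _] bE; rewrite bE; apply: contraNN => va3.
  by rewrite [a3](pair_set_eq card_a3 va3 za3).
case: inx2 inx3 => [/(nux _ adj2)//|E2|E2] [/(nux _ adj3)//|E3|E3];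
  try by rewrite E2 E3 eqxx in b23.
- by move: (nvz _ adj2 E2); rewrite (nvx _ adj3 E3).
- by move: (nvz _ adj3 E3); rewrite (nvx _ adj2 E2).
Qed.

(** The hypotheses of [K33_common] are invariant under exchanging the sides and under swapping the
    last two edges of a side, so each of the four edges can take the role of [a2]. *)
Lemma K33_star u a1 a2 a3 b1 b2 b3 :
  all (fun a : {set V} => #|a| == 2) [:: a1; a2; a3; b1; b2; b3] ->
  uniq [:: a1; a2; a3] -> uniq [:: b1; b2; b3] ->
  allrel sadj [:: a1; a2; a3] [:: b1; b2; b3] ->
  u \in a1 -> u \in b1 -> [&& u \in a2, u \in a3, u \in b2 & u \in b3].
Proof.
move=> /allP card_2 uniq_a uniq_b /allrelP adj ua ub.
have swap (c1 c2 c3 : {set V}) : perm_eq [:: c1; c2; c3] [:: c1; c3; c2].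
  by rewrite perm_cons (perm_catC [:: c2] [:: c3]).
have common a1' a2' a3' b1' b2' b3' :
    perm_eq ([:: a1; a2; a3] ++ [:: b1; b2; b3])
            ([:: a1'; a2'; a3'] ++ [:: b1'; b2'; b3']) ->
    uniq [:: a1'; a2'; a3'] -> uniq [:: b1'; b2'; b3'] ->
    (forall a b, a \in [:: a1'; a2'; a3'] -> b \in [:: b1'; b2'; b3'] -> sadj a b) ->
    u \in a1' -> u \in b1' -> u \in a2'.
  move=> perm_ab ua' ub' adj'; apply: (@K33_common _ a1' a2' a3' b1' b2' b3') => // a.
  by rewrite -[a \in _](perm_mem perm_ab) => /card_2/eqP.
apply/and4P; split.
- exact: (common a1 a2 a3 b1 b2 b3).
- apply: (common a1 a3 a2 b1 b2 b3) => //.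
  + by rewrite perm_cat2r swap.
  + by rewrite -(perm_uniq (swap a1 a2 a3)).
  + by move=> a b; rewrite -(perm_mem (swap a1 a2 a3)) => ? ?; exact: adj.
- apply: (common b1 b2 b3 a1 a2 a3) => //; first by rewrite perm_catC.
  by move=> a b ? ?; rewrite sadj_sym; exact: adj.
- apply: (common b1 b3 b2 a1 a2 a3) => //.
  + by rewrite perm_catC perm_cat2r swap.
  + by rewrite -(perm_uniq (swap b1 b2 b3)).
  + move=> a b; rewrite -(perm_mem (swap b1 b2 b3)) => ? ?.
    by rewrite sadj_sym; exact: adj.
Qed.

End Sets.

(** * Interval representations *)

(* [Code u v z x y s t] stands for the four edges e = uv, f = uz, g = ux or zx
   and h = uy or vy; as g meets f and h meets e, two bits are enough to choose
   between the alternatives. *)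
Record code (T : Type) := Code {
  c_u : T; c_v : T; c_z : T; c_x : T; c_y : T; c_s : bool; c_t : bool }.

Definition c_e T (c : code T) : T * T := (c_u c, c_v c).
Definition c_f T (c : code T) : T * T := (c_u c, c_z c).
Definition c_g T (c : code T) : T * T := (if c_s c then c_z c else c_u c, c_x c).
Definition c_h T (c : code T) : T * T := (if c_t c then c_v c else c_u c, c_y c).

Definition code_covers (T : eqType) (c : code T) : rel (T * T) :=
  covered (c_u c) (c_e c) (c_g c) (c_h c) (c_f c).

Definition ends (V : finType) (a : V * V) : {set V} := [set a.1; a.2].

Definition code_scovers (V : finType) (c : code V) : rel {set V} :=
  scovered (c_u c) (ends (c_e c)) (ends (c_g c)) (ends (c_h c)) (ends (c_f c)).

Lemma code_coversE (V : finType) (c : code V) a b :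
  code_covers c a b = code_scovers c (ends a) (ends b).
Proof. exact: covered_set. Qed.

Lemma card_edge (V : finType) (G : sgraph V) (a : edge_type G) : #|val a| = 2.
Proof.
case: a => a /= /imsetP[[p q]]; rewrite inE /= => Gpq ->.
by rewrite cards2; case: eqP Gpq => // ->; rewrite adj_irrefl.
Qed.

(* When no pair avoids both e and f, the degenerate choice g = e, h = f is used. *)
Lemma intervals_extremal (disp : Order.disp_t) (R : orderType disp) (I : finType)
    (l r : I -> R) (a0 b0 : I) : (r a0 < l b0)%O ->
  exists e g h f,
    [/\ (r e < l h)%O, (r e < l f)%O, (r g < l h)%O & (r g < l f)%O] /\
    forall a b, (r a < l b)%O ->
      [\/ a = e, b = f |
        [/\ e != g, h != f, a != e & b != f] /\
        [/\ (r e <= r a)%O, (r g <= r a)%O, (l b <= l h)%O & (l b <= l f)%O]].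
Proof.
move=> lt0.
case: (@arg_minP _ _ _ a0 xpredT r isT) => e _ min_e.
case: (@arg_maxP _ _ _ a0 xpredT l isT) => f _ max_f.
have ef : (r e < l f)%O.
  exact: le_lt_trans (min_e a0 isT) (lt_le_trans lt0 (max_f b0 isT)).
have [|no_inner] :=
    pselect (exists a b, [/\ (r a < l b)%O, a != e & b != f]); last first.
  exists e, e, f, f; split=> // a b lt_ab.
  have [ae|ae] := eqVneq a e; first by constructor 1.
  have [bf|bf] := eqVneq b f; first by constructor 2.
  by case: no_inner; exists a, b.
case=> [a1 [b1 [lt1 a1e b1f]]].
case: (@arg_minP _ _ _ a1 (fun a => a != e) r a1e) => g ge min_g.
case: (@arg_maxP _ _ _ b1 (fun b => b != f) l b1f) => h hf max_h.
have gh : (r g < l h)%O.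
  exact: le_lt_trans (min_g a1 a1e) (lt_le_trans lt1 (max_h b1 b1f)).
have eg := min_e g isT; have fh := max_f h isT.
exists e, g, h, f; split.
  split=> //; first exact: le_lt_trans gh.
  exact: lt_le_trans gh fh.
move=> a b lt_ab.
have [ae|ae] := eqVneq a e; first by constructor 1.
have [bf|bf] := eqVneq b f; first by constructor 2.
constructor 3; split; first by rewrite eq_sym.
by split; [exact: min_e|exact: min_g|exact: max_h|exact: max_f].
Qed.

(** Only an inclusion is claimed: the code may cover more pairs than the given intervals separate,
    which does no harm by [code_representation]. *)
Lemma interval_order_covered (V : finType) (G : sgraph V) (disp : Order.disp_t)
    (R : orderType disp) (l r : edge_type G -> R) (u0 : V) :
  (forall a b, (r a < l b)%O -> line_adj a b) ->
  exists c : code V, forall a b, (r a < l b)%O -> code_scovers c (val a) (val b).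
Proof.
move=> adj_lr.
have [[a0 [b0 lt0]]|none] := pselect (exists a b, (r a < l b)%O); last first.
  (* There is nothing to cover, so any code will do. *)
  exists (Code u0 u0 u0 u0 u0 false false) => a b lt_ab.
  by case: none; exists a, b.
have [e [g [h [f [[eh ef gh gf] inner]]]]] := intervals_extremal lt0.
have adj_in a b : (r a < l b)%O -> sadj (val a) (val b) by move/adj_lr.
have /andP[_ /pred0Pn[u /andP[/= ue uf]]] := adj_in _ _ ef.
have [v uv eE] := pair_setP (card_edge e) ue.
have [z uz fE] := pair_setP (card_edge f) uf.
have [s [x gE]] : exists (s : bool) x, val g = [set (if s then z else u); x].
  have /andP[_ /pred0Pn[w /andP[/= wg]]] := adj_in _ _ gf.
  rewrite fE => /set2P[]wE; have [x _ gE] := pair_setP (card_edge g) wg.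
    by exists false, x; rewrite gE wE.
  by exists true, x; rewrite gE wE.
have [t [y hE]] : exists (t : bool) y, val h = [set (if t then v else u); y].
  have /andP[_ /pred0Pn[w /andP[/= + wh]]] := adj_in _ _ eh.
  rewrite eE => /set2P[]wE; have [y _ hE] := pair_setP (card_edge h) wh.
    by exists false, y; rewrite hE wE.
  by exists true, y; rewrite hE wE.
exists (Code u v z x y s t) => a b lt_ab.
rewrite /code_scovers /ends /= -eE -fE -gE -hE /scovered.
rewrite (adj_in _ _ eh) (adj_in _ _ ef) (adj_in _ _ gh) (adj_in _ _ gf) /=.
case: (inner a b lt_ab) => [->|->|[[eg hf ae bf] [le_ea le_ga le_bh le_bf]]].
- by rewrite eqxx.
- by rewrite eqxx !orbT.
have eb := le_lt_trans le_ea lt_ab; have gb := le_lt_trans le_ga lt_ab.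
have ah := lt_le_trans lt_ab le_bh; have af := lt_le_trans lt_ab le_bf.
have [ag|ag] := eqVneq a g.
  by rewrite ag eqxx (sadj_sym (val b)) (adj_in _ _ eb) !orbT.
have [bh|bh] := eqVneq b h.
  by rewrite bh eqxx (adj_in _ _ af) !orbT.
have neqV (c d : edge_type G) : c != d -> val c != val d by rewrite (inj_eq val_inj).
have ga : val a != val g by exact: neqV.
have hb : val b != val h by exact: neqV.
have {}eg := neqV _ _ eg; have {}hf := neqV _ _ hf.
have {}ae := neqV _ _ ae; have {}bf := neqV _ _ bf.
have : [&& u \in val g, u \in val a, u \in val h & u \in val b].
  apply: (K33_star _ _ _ _ ue uf); rewrite /= ?andbT.
  - by rewrite !card_edge.
  - by rewrite !inE negb_or eg eq_sym ae eq_sym.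
  - by rewrite !inE negb_or eq_sym hf eq_sym bf eq_sym.
  - by rewrite /allrel /= !adj_in.
by case/and4P=> -> -> -> ->; rewrite !orbT.
Qed.

(** * Boxes as families of intervals *)

Section BoxRepresentations.
Local Open Scope ring_scope.

(** Boxes meet iff their projections meet in every coordinate: the coordinatewise maximum of the
    lower corners is then a common point. *)
Lemma box_representableP (R : realType) (V : finType) (H : sgraph V) (d : nat) :
  box_representable R H d <->
  exists l r : 'I_d -> V -> R, (forall i v, l i v <= r i v) /\
    forall a b, a != b -> H a b <-> forall i, (l i a <= r i b) && (l i b <= r i a).
Proof.
split=> [[B [boxB HB]]|[l [r [le_lr Hlr]]]].
  have /choice[lr lrP] : forall v, exists p : 'rV[R]_d * 'rV[R]_d,
      (forall i, p.1 0 i <= p.2 0 i) /\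
      B v = [set x : 'rV[R]_d | forall i, p.1 0 i <= x 0 i <= p.2 0 i]%classic.
    by move=> v; have [p [q pq]] := boxB v; exists (p, q).
  exists (fun i v => (lr v).1 0 i), (fun i v => (lr v).2 0 i); split.
    by move=> i v; have [] := lrP v.
  move=> a b neq_ab; rewrite HB // (lrP a).2 (lrP b).2; split.
    move=> [x [/= xa xb]] i.
    have /andP[xa1 xa2] := xa i; have /andP[xb1 xb2] := xb i.
    by rewrite (le_trans xa1 xb2) (le_trans xb1 xa2).
  move=> meet; exists (\row_i Num.max ((lr a).1 0 i) ((lr b).1 0 i)).
  have lea i := (lrP a).1 i; have leb i := (lrP b).1 i.
  split=> i; have /andP[ab ba] := meet i; rewrite !mxE le_max ge_max lexx ?orbT /=.
    by rewrite lea ba.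
  by rewrite ab leb.
exists (fun v => [set x : 'rV[R]_d | forall i, l i v <= x 0 i <= r i v]%classic).
split=> [v|a b neq_ab].
  exists (\row_i l i v), (\row_i r i v); split; first by move=> i; rewrite !mxE.
  by apply/seteqP; split=> x /= xP i; have := xP i; rewrite !mxE.
rewrite Hlr //; split.
  move=> meet; exists (\row_i Num.max (l i a) (l i b)).
  split=> i; have /andP[ab ba] := meet i; rewrite !mxE le_max ge_max lexx ?orbT /=.
    by rewrite le_lr ba.
  by rewrite ab le_lr.
move=> [x [/= xa xb]] i.
have /andP[xa1 xa2] := xa i; have /andP[xb1 xb2] := xb i.
by rewrite (le_trans xa1 xb2) (le_trans xb1 xa2).
Qed.

(** The dimension may be smaller than [k]; missing coordinates are filled up later, by arbitrary
    codes. *)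
Lemma boxicity_leP (R : realType) (V : finType) (H : sgraph V) (k : nat) :
  (boxicity R H <= k)%N <-> exists2 d, (d <= k)%N & box_representable R H d.
Proof.
rewrite /boxicity; case: ex_minnP => m /asboolP rep_m min_m; split.
  by move=> le_mk; exists m.
by move=> [d le_dk /asboolP/min_m/leq_trans->].
Qed.

(** A code whose four adjacencies fail covers nothing, and then all intervals can be the single
    point 0. *)
Lemma code_representation (V : finType) (c : code V) : exists l r : {set V} -> nat,
  [/\ forall a, (l a <= r a)%N, forall a b, (r a < l b)%N -> sadj a b &
      forall a b, sadj a b -> code_scovers c a b -> (r a < l b)%N \/ (r b < l a)%N].
Proof.
have ue : c_u c \in ends (c_e c) by rewrite !inE eqxx.
have uf : c_u c \in ends (c_f c) by rewrite !inE eqxx.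
move: ue uf; rewrite /code_scovers; set e := ends (c_e c); set f := ends (c_f c).
set g := ends (c_g c); set h := ends (c_h c); set u := c_u c => ue uf.
have [/and4P[eh ef gh gf]|bad] := boolP [&& sadj e h, sadj e f, sadj g h & sadj g f].
  exists (lft u e g h f), (rgt u e g h f); split=> [a|a b|a b].
  - exact: lft_le_rgt.
  - exact: rgt_lft_sadj.
  - exact: covered_rgt_lft.
exists (fun=> 0%N), (fun=> 0%N); split=> // a b _.
by case/and5P=> eh ef gh gf; rewrite eh ef gh gf in bad.
Qed.

(** Separation in a coordinate forces adjacency in L(G), so each coordinate yields a code;
    conversely, the intervals of a code separate every adjacent pair that it covers and no
    non-adjacent pair. The vertex [u0] guarantees that codes exist. *)
Lemma boxicity_compl_line_graph (R : realType) (V : finType) (G : sgraph V)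
    (k : nat) (u0 : V) :
  (boxicity R (compl_graph (line_graph G)) <= k)%N <->
  exists c : nat -> code V, forall a b : edge_type G, line_adj a b ->
    exists2 i, (i < k)%N & code_scovers (c i) (val a) (val b).
Proof.
rewrite boxicity_leP; split.
  case=> d le_dk /box_representableP[l [r [le_lr Hlr]]].
  have adj_lr i a b : r i a < l i b -> line_adj a b.
    move=> lt_ab; have neq_ab : a != b.
      by apply: contraTneq lt_ab => ->; rewrite -leNgt.
    apply: contraTT isT => nadj; have : compl_graph (line_graph G) a b.
      by rewrite /= /compl_adj neq_ab.
    by move/(Hlr a b neq_ab)/(_ i)/andP => [_]; rewrite leNgt lt_ab.
  have /choice[c cP] : forall i : 'I_d, exists c : code V, forall a b,
      r i a < l i b -> code_scovers c (val a) (val b).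
    by move=> i; apply: interval_order_covered u0 (adj_lr i).
  (* Indices from [d] on get an arbitrary code; more codes can only cover more. *)
  exists (fun i => if insub i is Some j then c j else Code u0 u0 u0 u0 u0 false false).
  move=> a b adj_ab; have neq_ab : a != b by case/andP: adj_ab.
  have [i lt_i] : exists i, (r i a < l i b) || (r i b < l i a).
    apply/not_existsP => no; suff : compl_graph (line_graph G) a b.
      by rewrite /= /compl_adj /= adj_ab andbF.
    apply/(Hlr a b neq_ab) => i; have /negP := no i.
    by rewrite negb_or -!leNgt andbC.
  exists i; first exact: leq_trans (ltn_ord i) le_dk.
  rewrite valK; case/orP: lt_i => [/cP //|/cP].
  by rewrite /code_scovers scovered_sym.
move=> [c cP]; exists k => //; apply/box_representableP.
have /choice[lr lrP] : forall i, exists lr : ({set V} -> nat) * ({set V} -> nat),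
    [/\ forall a, (lr.1 a <= lr.2 a)%N, forall a b, (lr.2 a < lr.1 b)%N -> sadj a b &
      forall a b, sadj a b -> code_scovers (c i) a b ->
        (lr.2 a < lr.1 b)%N \/ (lr.2 b < lr.1 a)%N].
  by move=> i; have [l [r lr]] := code_representation (c i); exists (l, r).
exists (fun i a => ((lr i).1 (val a))%:R), (fun i a => ((lr i).2 (val a))%:R).
split=> [i v|a b neq_ab]; first by rewrite ler_nat; case: (lrP i).
rewrite /= /compl_adj neq_ab /=; split=> [nadj i|meet].
  rewrite !ler_nat; have [_ adj_lr _] := lrP i.
  apply/andP; split; rewrite leqNgt; apply: contraNN nadj => /adj_lr //.
  by rewrite sadj_sym.
apply/negP => /[dup] adj_ab /cP[i lt_ik cov]; have [_ _ cov_lr] := lrP i.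
have := meet (Ordinal lt_ik); rewrite !ler_nat /= => /andP[le1 le2].
by case: (cov_lr _ _ adj_ab cov); rewrite ltnNge ?le1 ?le2.
Qed.

End BoxRepresentations.

(** * The program *)

(** Truth values are the numbers 0 and 1 and connectives are arithmetic, so the loop body contains
    no jumps. *)
Definition EAnd := EBin OpMul.
Definition ENot (e : expr) := EBin OpSub (ECst 1) e.
Definition EOr (e1 e2 : expr) := ENot (EAnd (ENot e1) (ENot e2)).
(** One of the two truncated differences is 0 and the other is the distance, so the outer difference
    is 1 exactly for equal values. *)
Definition EEq (e1 e2 : expr) :=
  EBin OpSub (ECst 1) (EBin OpAdd (EBin OpSub e1 e2) (EBin OpSub e2 e1)).
Definition EIf (c e1 e2 : expr) :=
  EBin OpAdd (EBin OpMul c e1) (EBin OpMul (ENot c) e2).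
Definition EExp (e : expr) (j : nat) := iter j (EBin OpMul e) (ECst 1).
Definition EMod (e1 e2 : expr) := EBin OpSub e1 (EBin OpMul (EBin OpDiv e1 e2) e2).

Definition ESame (a b : expr * expr) :=
  EOr (EAnd (EEq a.1 b.1) (EEq a.2 b.2)) (EAnd (EEq a.1 b.2) (EEq a.2 b.1)).
Definition EOn (u : expr) (a : expr * expr) := EOr (EEq u a.1) (EEq u a.2).
Definition EAdj (a b : expr * expr) :=
  EAnd (ENot (ESame a b)) (EOr (EOn a.1 b) (EOn a.2 b)).
Definition ECovered (u : expr) (e g h f a b : expr * expr) :=
  EAnd (EAdj e h) (EAnd (EAdj e f) (EAnd (EAdj g h) (EAnd (EAdj g f)
    (EOr (ESame a e) (EOr (ESame b e) (EOr (ESame a f) (EOr (ESame b f)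
    (EOr (EAnd (ESame a g) (EAdj b e)) (EOr (EAnd (ESame b g) (EAdj a e))
    (EOr (EAnd (ESame a h) (EAdj b f)) (EOr (EAnd (ESame b h) (EAdj a f))
    (EAnd (EOn u a) (EAnd (EOn u b) (EAnd (EOn u g) (EOn u h))))))))))))))).

Section Eval.
Variables (r m : nat -> nat).
Notation ev := (eval r m).
Let ev2 (a : expr * expr) := (ev a.1, ev a.2).

Lemma eval_and e1 e2 (b1 b2 : bool) : ev e1 = b1 -> ev e2 = b2 ->
  ev (EAnd e1 e2) = b1 && b2.
Proof. by move=> /= -> ->; rewrite mulnb. Qed.

Lemma eval_not e (b : bool) : ev e = b -> ev (ENot e) = ~~ b.
Proof. by move=> /= ->; case: b. Qed.

Lemma eval_or e1 e2 (b1 b2 : bool) : ev e1 = b1 -> ev e2 = b2 ->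
  ev (EOr e1 e2) = b1 || b2.
Proof. by move=> /= -> ->; case: b1 b2 => [] []. Qed.

Lemma eval_eq e1 e2 : ev (EEq e1 e2) = (ev e1 == ev e2).
Proof. by rewrite /=; case: eqP; lia. Qed.

Lemma eval_if c e1 e2 (b : bool) : ev c = b ->
  ev (EIf c e1 e2) = if b then ev e1 else ev e2.
Proof. by move=> /= ->; case: b; rewrite /= ?mul1n ?mul0n ?addn0. Qed.

Lemma eval_exp e j : ev (EExp e j) = ev e ^ j.
Proof. by elim: j => //= j; rewrite expnS => ->. Qed.

Lemma eval_mod e1 e2 : ev (EMod e1 e2) = ev e1 %% ev e2.
Proof. by rewrite /= {1}(divn_eq (ev e1) (ev e2)) addKn. Qed.

Lemma eval_same a b : ev (ESame a b) = same_pair (ev2 a) (ev2 b).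
Proof. by apply: eval_or; apply: eval_and; apply: eval_eq. Qed.

Lemma eval_on u a : ev (EOn u a) = on_pair (ev u) (ev2 a).
Proof. by apply: eval_or; apply: eval_eq. Qed.

Lemma eval_adj a b : ev (EAdj a b) = adj_pair (ev2 a) (ev2 b).
Proof.
apply: eval_and; first exact: eval_not (eval_same a b).
by apply: eval_or; apply: eval_on.
Qed.

Lemma eval_covered u e g h f a b :
  ev (ECovered u e g h f a b) =
  covered (ev u) (ev2 e) (ev2 g) (ev2 h) (ev2 f) (ev2 a) (ev2 b).
Proof.
by do ?[exact: eval_adj | exact: eval_same | exact: eval_on
       | apply: eval_and | apply: eval_or].
Qed.

End Eval.

Section VarsLt.
Variable w : nat.
Notation lt := (vars_lt w).

Lemma vars_lt_and e1 e2 : lt e1 -> lt e2 -> lt (EAnd e1 e2).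
Proof. by move=> /= -> ->. Qed.

Lemma vars_lt_not e : lt e -> lt (ENot e).
Proof. by []. Qed.

Lemma vars_lt_or e1 e2 : lt e1 -> lt e2 -> lt (EOr e1 e2).
Proof. by move=> /= -> ->. Qed.

Lemma vars_lt_eq e1 e2 : lt e1 -> lt e2 -> lt (EEq e1 e2).
Proof. by move=> /= -> ->. Qed.

Lemma vars_lt_if e1 e2 e3 : lt e1 -> lt e2 -> lt e3 -> lt (EIf e1 e2 e3).
Proof. by move=> /= -> -> ->. Qed.

Lemma vars_lt_exp e j : lt e -> lt (EExp e j).
Proof. by move=> lt_e; elim: j => //= j ->; rewrite lt_e. Qed.

Lemma vars_lt_mod e1 e2 : lt e1 -> lt e2 -> lt (EMod e1 e2).
Proof. by move=> /= -> ->. Qed.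

Lemma vars_lt_bin op e1 e2 : lt e1 -> lt e2 -> lt (EBin op e1 e2).
Proof. by move=> /= -> ->. Qed.

Let lt2 (a : expr * expr) := lt a.1 && lt a.2.

Lemma vars_lt_same a b : lt2 a -> lt2 b -> lt (ESame a b).
Proof.
move=> /andP[? ?] /andP[? ?].
by apply: vars_lt_or; apply: vars_lt_and; apply: vars_lt_eq.
Qed.

Lemma vars_lt_on u a : lt u -> lt2 a -> lt (EOn u a).
Proof. by move=> ? /andP[? ?]; apply: vars_lt_or; apply: vars_lt_eq. Qed.

Lemma vars_lt_adj a b : lt2 a -> lt2 b -> lt (EAdj a b).
Proof.
move=> /[dup] ? /andP[? ?] ?; apply: vars_lt_and.
  by apply: vars_lt_not; apply: vars_lt_same.
by apply: vars_lt_or; apply: vars_lt_on.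
Qed.

Lemma vars_lt_covered u e g h f a b :
  lt u -> lt2 e -> lt2 g -> lt2 h -> lt2 f -> lt2 a -> lt2 b ->
  lt (ECovered u e g h f a b).
Proof.
move=> *; do ?[exact: vars_lt_adj | exact: vars_lt_same | exact: vars_lt_on
              | apply: vars_lt_and | apply: vars_lt_or].
Qed.
End VarsLt.

(** * Encoding codes by numbers *)

Definition digit (b q j : nat) : nat := q %/ b ^ j %% b.

Lemma digit0 b c q : c < b -> digit b (c + b * q) 0 = c.
Proof. by move=> lt_c; rewrite /digit divn1 mulnC addnC modnMDl modn_small. Qed.

Lemma divn_expS b c q j : c < b -> (c + b * q) %/ b ^ j.+1 = q %/ b ^ j.
Proof.
move=> lt_c; have b_gt0 : 0 < b by exact: leq_trans lt_c.
by rewrite expnS divnMA mulnC addnC divnMDl // (divn_small lt_c) addn0.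
Qed.

Lemma digitS b c q j : c < b -> digit b (c + b * q) j.+1 = digit b q j.
Proof. by move=> lt_c; rewrite /digit divn_expS. Qed.

Lemma digit_lt b q j : 0 < b -> digit b q j < b.
Proof. exact: ltn_pmod. Qed.

Lemma cons_digit_lt b B c q : c < b -> q < B -> c + b * q < b * B.
Proof. by nia. Qed.

Lemma digits_onto b k (q : nat -> nat) : (forall i, i < k -> q i < b) ->
  exists2 C, C < b ^ k & forall i, i < k -> digit b C i = q i.
Proof.
elim: k q => [|k IH] q lt_q; first by exists 0.
have [C lt_C digC] := IH (fun i => q i.+1) (fun i => lt_q i.+1).
exists (q 0 + b * C); first by rewrite expnS; apply: cons_digit_lt => //; apply: lt_q.
case=> [_|i lt_i]; first by rewrite digit0 // lt_q.
by rewrite digitS ?digC // lt_q.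
Qed.

Definition code_base (n : nat) : nat := 4 * n ^ 5.

(** Since [q] is below [4 * n ^ 5], its quotient by [n ^ 5] is [s + 2 * t] for the two bits s and
    t. *)
Definition nat_code (n C i : nat) : code nat :=
  let q := digit (code_base n) C i in
  Code (digit n q 0) (digit n q 1) (digit n q 2) (digit n q 3) (digit n q 4)
       (odd (q %/ n ^ 5)) (odd (q %/ (2 * n ^ 5))).

Definition map_code (T U : Type) (f : T -> U) (c : code T) : code U :=
  Code (f (c_u c)) (f (c_v c)) (f (c_z c)) (f (c_x c)) (f (c_y c)) (c_s c) (c_t c).

(** Covering only tests vertices for equality, so it can be evaluated on the numbers of the
    vertices. *)
Lemma code_covers_map (T U : eqType) (f : T -> U) (c : code T) (a b : T * T) :
  injective f ->
  code_covers (map_code f c) (f a.1, f a.2) (f b.1, f b.2) = code_covers c a b.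
Proof.
move=> inj_f; rewrite /code_covers /c_e /c_g /c_h /c_f /map_code /=.
rewrite -!(fun_if f) /covered /adj_pair /same_pair /on_pair /=.
by rewrite !(inj_eq inj_f).
Qed.

Lemma nat_code_onto n k (c : nat -> code 'I_n) :
  exists2 C, C < code_base n ^ k &
    forall i, i < k -> nat_code n C i = map_code val (c i).
Proof.
pose q i := c_u (c i) + n * (c_v (c i) + n * (c_z (c i) + n * (c_x (c i) + n *
  (c_y (c i) + n * (c_s (c i) + 2 * c_t (c i)))))).
have lt_q i : q i < code_base n.
  rewrite /code_base (_ : 4 * _ = n * (n * (n * (n * (n * 4))))); last by lia.
  do 5!apply: cons_digit_lt => //.
  by case: c_s; case: c_t.
have [C lt_C digC] := digits_onto (k := k) (fun i _ => lt_q i).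
exists C => // i lt_i; rewrite /nat_code digC // /map_code.
rewrite !(digit0, digitS) //.
have div5 : q i %/ n ^ 5 = c_s (c i) + 2 * c_t (c i).
  by rewrite /q !divn_expS // divn1.
rewrite mulnC divnMA div5; congr Code; first by case: c_s; case: c_t.
by case: c_s; case: c_t.
Qed.

(** The search meets no invalid candidates: every number decodes to a genuine code, so a success of
    the program always comes from a cover. *)
Lemma nat_code_ord n C i : 0 < n ->
  exists c : code 'I_n, nat_code n C i = map_code val c.
Proof.
move=> n_gt0; have lt q j := digit_lt q j n_gt0.
pose o q j := Ordinal (lt q j); pose q := digit (code_base n) C i.
by exists (Code (o q 0) (o q 1) (o q 2) (o q 3) (o q 4)
            (odd (q %/ n ^ 5)) (odd (q %/ (2 * n ^ 5)))).
Qed.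

Definition EN := EVar 0.
Definition ET := EVar 1.
Definition EGood := EVar 2.
Definition EAns := EVar 3.

Definition EDigit (b e : expr) (j : nat) := EMod (EBin OpDiv e (EExp b j)) b.
Definition EBase := EBin OpMul (ECst 4) (EExp EN 5).
Definition EBlock := EExp EN 3.
Definition EFactor (i : nat) := EDigit EBase (EBin OpDiv ET EBlock) i.

Definition EA := (EDigit EN ET 0, EDigit EN ET 1).
Definition EB := (EDigit EN ET 0, EDigit EN ET 2).

Definition ECovers (i : nat) :=
  let q := EFactor i in
  let d := EDigit EN q in
  let s := EMod (EBin OpDiv q (EExp EN 5)) (ECst 2) in
  let t := EMod (EBin OpDiv q (EBin OpMul (ECst 2) (EExp EN 5))) (ECst 2) in
  ECovered (d 0) (d 0, d 1) (EIf s (d 2) (d 0), d 3) (EIf t (d 1) (d 0), d 4)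
    (d 0, d 2) EA EB.

Definition ESomeCovers (k : nat) :=
  foldr (fun i => EOr (ECovers i)) (ECst 0) (iota 0 k).

Definition EAdjacent (a : expr * expr) :=
  EEq (ECell (EBin OpAdd (EBin OpMul a.1 EN) a.2)) (ECst 1).

Definition EOk (k : nat) :=
  EOr (ENot (EAnd (EAdjacent EA) (EAnd (EAdjacent EB) (ENot (EEq EA.2 EB.2)))))
    (ESomeCovers k).

Definition EBoundary := EEq (EMod ET EBlock) (ECst 0).

(** For [n = 0] the counter is 0 and the loop never runs; register 3 therefore starts at 1 in this
    case, the answer for the graph without vertices. *)
Definition program_init (k : nat) : block :=
  [:: (1, EBin OpMul (EExp EBase k) EBlock); (2, ECst 1); (3, ENot EN)].

(* The counter in register 1 encodes, in base n, the three vertices of a pair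
   of incident edges and above them k codes. Register 2 tells whether the
   current codes cover all pairs met so far, register 3 whether some codes
   already covered all pairs. *)
Definition program_body (k : nat) : block :=
  [:: (1, EBin OpSub ET (ECst 1));
      (2, EAnd EGood (EOk k));
      (3, EOr EAns (EAnd EGood EBoundary));
      (2, EOr EGood EBoundary)].

Definition program_fin : block := [:: (0, EAns)].

Definition counter (n k : nat) : nat := code_base n ^ k * n ^ 3.

(** * The loop invariant *)

Section Semantics.
Variables (m : nat -> nat) (n k : nat).

Definition nat_pair (t : nat) : (nat * nat) * (nat * nat) :=
  ((digit n t 0, digit n t 1), (digit n t 0, digit n t 2)).

Definition some_covers (t : nat) : bool :=
  has (fun i => code_covers (nat_code n (t %/ n ^ 3) i)
    (nat_pair t).1 (nat_pair t).2) (iota 0 k).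

Definition cell_adj (a : nat * nat) : bool := m (a.1 * n + a.2) == 1.

Definition ok (t : nat) : bool :=
  let: (a, b) := nat_pair t in
  ~~ [&& cell_adj a, cell_adj b & a.2 != b.2] || some_covers t.

Section EvalProgram.
Variable v : nat -> nat.
Hypothesis v0 : v 0 = n.

Lemma eval_digit b e j : eval v m (EDigit b e j) = digit (eval v m b) (eval v m e) j.
Proof. by rewrite /EDigit eval_mod /= eval_exp. Qed.

Lemma eval_expn j : eval v m (EExp EN j) = n ^ j.
Proof. by rewrite eval_exp /= v0. Qed.

Lemma eval_EBase : eval v m EBase = code_base n.
Proof. by rewrite -[LHS]/(4 * eval v m (EExp EN 5)) eval_expn. Qed.

Lemma eval_EBlock : eval v m EBlock = n ^ 3.
Proof. exact: eval_expn. Qed.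

Lemma eval_covers i : eval v m (ECovers i) =
  code_covers (nat_code n (v 1 %/ n ^ 3) i) (nat_pair (v 1)).1 (nat_pair (v 1)).2.
Proof.
have eq_q : eval v m (EFactor i) = digit (code_base n) (v 1 %/ n ^ 3) i.
  by rewrite eval_digit eval_EBase -eval_EBlock.
rewrite /ECovers; move: (EFactor i) eq_q => q eq_q.
rewrite eval_covered !eval_digit eq_q.
have eval_odd e1 e2 : eval v m (EMod (EBin OpDiv e1 e2) (ECst 2)) =
    odd (eval v m e1 %/ eval v m e2) by rewrite eval_mod modn2.
rewrite !(eval_if _ _ (eval_odd _ _)) !eval_digit eq_q.
rewrite -[eval v m (EBin OpMul (ECst 2) (EExp EN 5))]/(2 * eval v m (EExp EN 5)).
by rewrite !eval_expn /= v0.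
Qed.

Lemma eval_some_covers : eval v m (ESomeCovers k) = some_covers (v 1).
Proof.
rewrite /ESomeCovers /some_covers; elim: (iota 0 k) => // i s IH.
by apply: eval_or IH; apply: eval_covers.
Qed.

Lemma eval_ok : eval v m (EOk k) = ok (v 1).
Proof.
apply: eval_or eval_some_covers; apply: eval_not.
have adjE a : eval v m (EAdjacent a) = cell_adj (eval v m a.1, eval v m a.2).
  by rewrite eval_eq /= v0.
apply: eval_and; first by rewrite adjE !eval_digit /= v0.
apply: eval_and; first by rewrite adjE !eval_digit /= v0.
by apply: eval_not; rewrite eval_eq !eval_digit /= v0.
Qed.

Lemma eval_boundary : eval v m EBoundary = (n ^ 3 %| v 1).
Proof. by rewrite eval_eq eval_mod eval_EBlock. Qed.

End EvalProgram.

Definition all_ok (j : nat) : bool :=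
  `[< forall t, j <= t -> t %/ n ^ 3 = j %/ n ^ 3 -> ok t >].

(** At a multiple [t] of [n ^ 3], [all_ok t] concerns the whole block of counter values that share
    one choice of codes. *)
Definition found (j : nat) : bool :=
  (n == 0) || `[< exists2 t, j <= t < counter n k & (n ^ 3 %| t) && all_ok t >].

(** At a multiple of [n ^ 3], register 2 stands at 1 for the next block below; the result of a
    finished block has been merged into register 3. *)
Definition loop_inv (j : nat) (v : nat -> nat) : Prop :=
  [/\ v 0 = n, v 1 = j, j <= counter n k,
      v 2 = (n ^ 3 %| j) || all_ok j & v 3 = found j].

(* Since the counter runs downwards, [all_ok j] concerns the pairs already
   tested with the codes [j %/ n ^ 3]. *)
Lemma all_okS j : 0 < n -> all_ok j = ((n ^ 3 %| j.+1) || all_ok j.+1) && ok j.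
Proof.
move=> n_gt0; have M_gt0 : 0 < n ^ 3 by rewrite expn_gt0 n_gt0.
have [M_dvd|M_ndvd] /= := boolP (n ^ 3 %| j.+1).
  apply/asboolP/idP => [|ok_j t le_jt t_j]; first by apply.
  (* Here [j] is the last number of its block, hence the first one to be tested. *)
  suff -> : t = j by [].
  apply/eqP; rewrite eqn_leq le_jt andbT -ltnS -(divnK M_dvd).
  rewrite -ltn_divLR // divnS // M_dvd t_j; lia.
have jS : j.+1 %/ n ^ 3 = j %/ n ^ 3 by rewrite divnS // (negPf M_ndvd).
apply/asboolP/andP => [all_j|[/asboolP all_jS ok_j] t].
  split; last exact: all_j.
  by apply/asboolP=> t lt_jt; rewrite jS; apply: all_j; apply: ltnW.
rewrite leq_eqVlt => /orP[/eqP<- //|lt_jt] t_j.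
by apply: all_jS => //; rewrite jS.
Qed.

Lemma foundS j : j < counter n k ->
  found j = found j.+1 || (n ^ 3 %| j) && all_ok j.
Proof.
move=> lt_j; rewrite /found -orbA; congr (_ || _).
apply/asboolP/orP => [[t /andP[le_jt lt_t] ok_t]|[/asboolP[t /andP[lt_jt lt_t] ok_t]|ok_j]].
- have [eq_jt|] := eqVneq j t; first by right; rewrite eq_jt.
  rewrite neq_ltn [t < j]ltnNge le_jt orbF => lt_jt; left; apply/asboolP.
  by exists t; rewrite ?lt_jt.
- by exists t; rewrite ?(ltnW lt_jt).
- by exists j; rewrite ?leqnn.
Qed.

Lemma loop_inv_step j v : loop_inv j.+1 v -> loop_inv j (eval_block m v (program_body k)).
Proof.
case=> v0 v1 lt_j v2 v3.
have n_gt0 : 0 < n.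
  by rewrite lt0n; apply: contraTneq lt_j => ->; rewrite /counter /code_base muln0.
rewrite /program_body; cbn [eval_block].
set w1 := upd v 1 _.
have w1_1 : w1 1 = j by rewrite /w1 /upd /= v1 subn1.
have g_w1 : eval w1 m (EAnd EGood (EOk k)) = all_ok j.
  rewrite all_okS //; apply: eval_and; first exact: v2.
  by rewrite eval_ok // w1_1.
rewrite g_w1; set w2 := upd w1 2 _.
have w2_1 : w2 1 = j by exact: w1_1.
have f_w2 : eval w2 m (EOr EAns (EAnd EGood EBoundary)) = found j.
  rewrite foundS //; apply: eval_or; first exact: v3.
  rewrite andbC; apply: eval_and; first by [].
  by rewrite eval_boundary // w2_1.
rewrite f_w2; set w3 := upd w2 3 _.
have w3_1 : w3 1 = j by exact: w1_1.
split=> //; first exact: ltnW.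
rewrite {1}/upd eqxx orbC; apply: eval_or; first by [].
by rewrite eval_boundary // w3_1.
Qed.

End Semantics.

(** * Correctness and running time *)

Lemma vars_lt_digit w b e j : vars_lt w b -> vars_lt w e -> vars_lt w (EDigit b e j).
Proof.
move=> lt_b lt_e; apply: vars_lt_mod => //; apply: vars_lt_bin => //.
exact: vars_lt_exp.
Qed.

Lemma vars_lt_covers i : vars_lt 4 (ECovers i).
Proof.
have lt_q : vars_lt 4 (EFactor i) by apply: vars_lt_digit.
rewrite /ECovers; move: (EFactor i) lt_q => q lt_q.
have lt_d j : vars_lt 4 (EDigit EN q j) by apply: vars_lt_digit.
have lt_odd e : vars_lt 4 e -> vars_lt 4 (EMod (EBin OpDiv q e) (ECst 2)).
  by move=> lt_e; apply: vars_lt_mod => //; apply: vars_lt_bin.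
have lt_n j : vars_lt 4 (EDigit EN ET j) by apply: vars_lt_digit.
have lt2 (a b : expr) : vars_lt 4 a -> vars_lt 4 b ->
    vars_lt 4 (a, b).1 && vars_lt 4 (a, b).2 by move=> /= -> ->.
apply: vars_lt_covered; first exact: lt_d.
- exact: lt2.
- by apply: lt2 => //; apply: vars_lt_if => //; apply/lt_odd/vars_lt_exp.
- by apply: lt2 => //; apply: vars_lt_if => //; apply/lt_odd/vars_lt_bin/vars_lt_exp.
- exact: lt2.
- exact: lt2.
- exact: lt2.
Qed.

Lemma vars_lt_ok k : vars_lt 4 (EOk k).
Proof.
apply: vars_lt_or => //; rewrite /ESomeCovers; elim: (iota 0 k) => // i s IH.
by apply: vars_lt_or IH; apply: vars_lt_covers.
Qed.

Lemma program_init_lt k : block_lt 4 (program_init k).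
Proof. by rewrite /= vars_lt_exp. Qed.

Lemma program_body_lt k : block_lt 4 (program_body k).
Proof.
rewrite /program_body; cbn [block_lt]; apply/and5P; split=> //.
exact: vars_lt_and (vars_lt_ok k).
Qed.

(** * The size of the numbers *)

Fixpoint block_val_le (K : nat) (m v : nat -> nat) (b : block) : bool :=
  if b is (x, e) :: b' then
    (eval v m e <= K) && block_val_le K m (upd v x (eval v m e)) b'
  else true.

Fixpoint block_degree (D : nat) (b : block) : nat :=
  if b is (x, e) :: b' then degree D e + block_degree D b' else 0.

(** A degree bounds a single evaluation and would grow with each iteration. Here the assigned values
    are known to stay within [a ^ D], so every assignment starts again from degree [D]. *)
Lemma block_le_degree w a D c m v b : 1 < a -> block_lt w b ->
  block_degree D b <= c -> (forall x, x < w -> v x <= a ^ D) ->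
  (forall i, m i <= 1) -> block_val_le (a ^ D) m v b -> block_le (a ^ c) m v b.
Proof.
move=> a_gt1 + + + le_m; elim: b v => //= [[x e] b IH] v.
move=> /and3P[lt_x lt_e lt_b] le_c le_v /andP[le_e le_b]; apply/andP; split.
  apply: sub_leW (sub_le_degree a_gt1 lt_e le_v le_m).
  by rewrite leq_exp2l // (leq_trans _ le_c) // leq_addr.
apply: IH => //; first by apply: leq_trans le_c; apply: leq_addl.
by move=> y lt_y; rewrite /upd; case: eqP => // _; apply: le_v.
Qed.

(** As 4 is at most [(n + 2) ^ 2], each of the k code numbers costs exponent 2 + 5, and the three
    vertices of a pair cost 3. *)
Definition var_exponent (k : nat) := 7 * k + 3.

Lemma counter_le n k : counter n k <= (n + 2) ^ var_exponent k.
Proof.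
have leX a b e : a <= b -> a ^ e <= b ^ e.
  by move=> le_ab; elim: e => // e; rewrite !expnS; apply: leq_mul.
rewrite /counter /var_exponent expnD expnM leq_mul ?leX ?leq_addr //.
rewrite /code_base (expnD _ 2 5) leq_mul ?leX ?leq_addr //.
by rewrite -[4]/(2 ^ 2) leX ?leq_addl.
Qed.

Lemma eval_not_le r m e : eval r m (ENot e) <= 1.
Proof. exact: leq_subr. Qed.

Lemma eval_or_le r m e1 e2 : eval r m (EOr e1 e2) <= 1.
Proof. exact: eval_not_le. Qed.

Definition cover_program (k : nat) : program :=
  loop_program 4 (program_init k) (program_body k) program_fin.

Definition cover_exponent (k : nat) : nat :=
  let D := var_exponent k in
  (D + block_degree D (program_init k) + block_degree D (program_body k)
   + block_degree D program_fin).

Definition cover_time (k n : nat) : nat :=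
  loop_head 4 (program_init k)
  + (counter n k * (size (compile_block 4 (program_body k)) + 3)).+1
  + size (compile_block 4 program_fin).

Lemma cover_time_bigO k : is_bigO (cover_time k) (fun n => n ^ (5 * k + 4)).
Proof.
pose a := loop_head 4 (program_init k); pose b := size (compile_block 4 (program_body k)) + 3.
pose c := size (compile_block 4 program_fin).
(* The factor [4 ^ k] goes into the constant; the threshold 1 excludes [n = 0], where the power
   vanishes but the time does not. *)
exists (a + 4 ^ k * b + 1 + c), 1 => n n_gt0.
rewrite /cover_time -/a -/b -/c.
have -> : counter n k = 4 ^ k * n ^ (5 * k + 3).
  by rewrite /counter /code_base expnMn -expnM expnD mulnA.
have le_n : n ^ (5 * k + 3) <= n ^ (5 * k + 4) by rewrite leq_pexp2l // leq_add2l.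
have n_pow : 0 < n ^ (5 * k + 4) by rewrite expn_gt0 n_gt0.
set N := n ^ (5 * k + 4) in le_n n_pow *; set N' := n ^ (5 * k + 3) in le_n *.
have -> : (4 ^ k * N' * b).+1 = 4 ^ k * b * N' + 1 by rewrite addn1 mulnAC.
rewrite !mulnDl addnA; do 3?apply: leq_add; rewrite ?leq_pmulr ?leq_mul //.
Qed.

Section Run.
Variables (n : nat) (G : sgraph 'I_n) (k : nat).

Let m := cell (input G).
Let B := (n + 2) ^ cover_exponent k.
Let K := (n + 2) ^ var_exponent k.

Lemma input_cell_le1 i : m i <= 1.
Proof. exact: leq_b1. Qed.

Lemma input_cell (i j : 'I_n) : m (i * n + j) = G i j.
Proof.
congr (nat_of_bool _); apply/existsP/idP => [[i' /existsP[j' /andP[/eqP eq_ij Gij]]]|Gij].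
  have n_gt0 : 0 < n by exact: leq_ltn_trans (ltn_ord i).
  have eq_i : i = i'.
    apply: val_inj; have := congr1 (fun a => a %/ n) eq_ij.
    by rewrite !divnMDl // !divn_small // !addn0.
  have eq_j : j = j'.
    by apply: val_inj; move/eqP: eq_ij; rewrite eq_i eqn_add2l => /eqP.
  by rewrite eq_i eq_j.
by exists i; apply/existsP; exists j; rewrite eqxx.
Qed.

Lemma K_gt0 : 0 < K. Proof. by rewrite expn_gt0 addn_gt0 orbT. Qed.

Lemma n_le_K : n <= K.
Proof.
rewrite (leq_trans (leq_addr 2 n)) // -{1}[n + 2]expn1 leq_pexp2l ?addn_gt0 ?orbT //.
Qed.

Lemma bool_le_K (b : bool) : b <= K.
Proof. exact: leq_trans (leq_b1 b) K_gt0. Qed.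

Lemma le1_K a : a <= 1 -> a <= K.
Proof. by move/leq_trans; apply; exact: K_gt0. Qed.

Let v0 : nat -> nat := fun x => if x == 0 then n else 0.

Lemma init_val_le : block_val_le K m v0 (program_init k).
Proof.
rewrite /program_init; cbn [block_val_le]; apply/and4P; split=> //.
- rewrite -[eval _ _ _]/(eval v0 m (EExp EBase k) * eval v0 m EBlock).
  by rewrite eval_exp (@eval_EBase m n v0 erefl) (@eval_EBlock m n v0 erefl) counter_le.
- exact: K_gt0.
- exact/le1_K/eval_not_le.
Qed.

Lemma loop_inv_init : loop_inv m n k (counter n k) (eval_block m v0 (program_init k)).
Proof.
rewrite /program_init; cbn [eval_block]; split=> //.
- rewrite /upd /= -[RHS]/(code_base n ^ k * n ^ 3).
  rewrite -[LHS]/(eval v0 m (EExp EBase k) * eval v0 m EBlock).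
  by rewrite eval_exp (@eval_EBase m n v0 erefl) (@eval_EBlock m n v0 erefl).
- by rewrite dvdn_mull.
- rewrite -[LHS]/(1 - n) /found (_ : `[< _ >] = false) ?orbF; first by case: (n).
  by apply/asboolP => -[t]; rewrite ltnNge andbN.
Qed.

Lemma body_val_le j v : loop_inv m n k j.+1 v -> block_val_le K m v (program_body k).
Proof.
case=> v_0 v_1 lt_j v_2 v_3.
rewrite /program_body; cbn [block_val_le]; apply/and5P; split=> //.
- by rewrite /= v_1 subn1 (leq_trans (ltnW lt_j)) // counter_le.
- rewrite -[eval _ _ _]/(v 2 * eval (upd v 1 (eval v m (EBin OpSub ET (ECst 1)))) m (EOk k)).
  by rewrite v_2 (@leq_trans (1 * 1)) ?leq_mul ?leq_b1 ?eval_or_le ?K_gt0.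
- exact/le1_K/eval_or_le.
- exact/le1_K/eval_or_le.
Qed.

Lemma loop_inv_le j v x : loop_inv m n k j v -> x < 4 -> v x <= K.
Proof.
case=> v_0 v_1 le_j v_2 v_3; case: x => [|[|[|[|x]]]] // _.
- by rewrite v_0 n_le_K.
- by rewrite v_1 (leq_trans le_j) // counter_le.
- by rewrite v_2 bool_le_K.
- by rewrite v_3 bool_le_K.
Qed.

Lemma bounded_input : bounded B (input G).
Proof.
have B_gt0 : 0 < B by rewrite expn_gt0 addn_gt0 orbT.
move=> a; split; last exact: leq_trans (input_cell_le1 a) B_gt0.
rewrite /=; case: eqP => // _; apply: leq_trans n_le_K _.
by apply: leq_pexp2l; [rewrite addn2 | rewrite /cover_exponent; lia].
Qed.

Lemma cover_program_reach : exists s,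
  [/\ reach (cover_program k) B (cover_time k n) (input G) s,
      halted (cover_program k) s & reg s 0 = found m n k 0].
Proof.
have n2_gt1 : 1 < n + 2 by rewrite addn2.
have init_le : block_le B m v0 (program_init k).
  apply: (@block_le_degree 4 _ (var_exponent k)) => //.
  - exact: program_init_lt.
  - by rewrite /cover_exponent; lia.
  - by rewrite /v0 => x _; case: eqP => // _; exact: n_le_K.
  - exact: input_cell_le1.
  - exact: init_val_le.
have body_le j v : loop_inv m n k j.+1 v -> block_le B m v (program_body k).
  move=> inv_v; apply: (@block_le_degree 4 _ (var_exponent k)) => //.
  - exact: program_body_lt.
  - by rewrite /cover_exponent; lia.
  - by move=> x; apply: loop_inv_le inv_v.
  - exact: input_cell_le1.
  - exact: body_val_le inv_v.
have fin_le v : loop_inv m n k 0 v -> block_le B m v program_fin.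
  move=> inv_v; apply: (@block_le_degree 4 _ (var_exponent k)) => //.
  - by rewrite /cover_exponent; lia.
  - by move=> x; apply: loop_inv_le inv_v.
  - exact: input_cell_le1.
  - by rewrite /= andbT; apply: loop_inv_le inv_v _.
have counterP j v : loop_inv m n k j v -> v 1 = j by case.
have [v [s [reach_s halt_s inv_v reg_s]]] :=
  @loop_programP 4 (program_init k) (program_body k) program_fin B m
    (loop_inv m n k) isT (program_body_lt k) counterP body_le
    (@loop_inv_step m n k) (program_init_lt k) isT (counter n k) v0
    init_le fin_le loop_inv_init bounded_input.
exists s; split=> //; rewrite reg_s //.
by case: inv_v.
Qed.

Lemma found_correct (R : realType) :
  found m n k 0 <-> boxicity R (compl_graph (line_graph G)) <= k.
Proof.
rewrite /found; case: posnP => [n0|n_gt0] /=.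
  (* Without vertices there are no edges, and the empty family of boxes works in dimension 0. *)
  split=> // _; apply/boxicity_leP; exists 0 => //.
  have no_edge (a : edge_type G) : False.
    case/imsetP: (valP a) => -[i _] _ _.
    by have := leq_ltn_trans (leq0n i) (ltn_ord i); rewrite n0.
  exists (fun a => match no_edge a with end).
  by split=> a; case: (no_edge a).
have M_gt0 : 0 < n ^ 3 by rewrite expn_gt0 n_gt0.
rewrite (boxicity_compl_line_graph R G k (Ordinal n_gt0)); split.
  case/asboolP=> t lt_t /andP[M_t /asboolP ok_t].
  pose C := t %/ n ^ 3.
  have /choice[c cP] i := nat_code_ord C i n_gt0.
  exists c => a b /andP[neq_ab /pred0Pn[x /andP[/= xa xb]]].
  have [y0 xy0 aE] := pair_setP (card_edge a) xa.
  have [y1 xy1 bE] := pair_setP (card_edge b) xb.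
  have adjV (e : edge_type G) (y : 'I_n) : val e = [set x; y] -> G x y.
    case/imsetP: (valP e) => -[p q]; rewrite inE /= => Gpq -> /eqP.
    rewrite -(same_pairE (p, q) (x, y)) /same_pair /=.
    case/orP=> /andP[/eqP<- /eqP<-] //; by rewrite adj_sym.
  have y01 : y0 != y1.
    apply: contraNneq neq_ab => y01; apply/eqP/val_inj.
    by rewrite /= aE bE y01.
  (* The counter value at which the pair [a], [b] is tested with the codes of [t]. *)
  pose t' := x + n * (y0 + n * (y1 + n * C)).
  have t'_div : t' %/ n ^ 3 = C by rewrite /t' !divn_expS // divn1.
  (* A multiple of [n ^ 3] is the least number of its block. *)
  have le_t : t <= t'.
    have -> : t = C * n ^ 3 by rewrite divnK.
    by rewrite -t'_div leq_trunc_div.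
  have := ok_t t' le_t t'_div; rewrite /ok /nat_pair => /orP[|].
    rewrite !digitS ?digit0 // /cell_adj /= !input_cell.
    by rewrite (adjV a) // (adjV b) // (inj_eq val_inj) y01.
  rewrite /some_covers /= t'_div => /hasP[i]; rewrite mem_iota /= => lt_i.
  rewrite /nat_pair !digitS ?digit0 //= cP.
  rewrite (code_covers_map (c i) (x, y0) (x, y1) val_inj) code_coversE => cov.
  by exists i; rewrite // [val a]aE [val b]bE.
move=> [c cP]; apply/asboolP.
have [C lt_C codeC] := nat_code_onto k c.
(* The countdown leaves the block of the codes [C] at its least number, where all pairs have been
   tested. *)
exists (C * n ^ 3); first by rewrite /= /counter ltn_pmul2r.
rewrite dvdn_mull //=; apply/asboolP=> t le_t; rewrite mulnK // => t_div.
rewrite /ok /= /some_covers t_div; apply/orP.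
have lt_d j := digit_lt t j n_gt0.
pose x := Ordinal (lt_d 0); pose y0 := Ordinal (lt_d 1); pose y1 := Ordinal (lt_d 2).
(* Counter values that do not describe two distinct incident edges are accepted vacuously. *)
have [/and3P[adj_a adj_b y01]|] := boolP [&& _, _ & _]; last by left.
right; move: adj_a adj_b y01.
rewrite /cell_adj /= (input_cell x y0) (input_cell x y1) !eqb1.
rewrite -[_ != _]/(val y0 != val y1) (inj_eq val_inj) => Ga Gb y01.
have edgeP (y : 'I_n) : G x y -> [set x; y] \in edges G.
  by move=> Gxy; apply/imsetP; exists (x, y); rewrite ?inE.
pose a : edge_type G := Sub [set x; y0] (edgeP _ Ga).
pose b : edge_type G := Sub [set x; y1] (edgeP _ Gb).
have adj_ab : line_adj a b.
  apply/andP; split.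
    rewrite -(inj_eq val_inj) /= -(same_pairE (x, y0) (x, y1)) /same_pair /= eqxx.
    rewrite (negPf y01) /= negb_and orbC; apply/orP; left.
    by apply: contraTneq (Ga) => ->; rewrite adj_irrefl.
  by apply/pred0Pn; exists x; rewrite /= !set21.
have [i lt_i cov] := cP a b adj_ab.
apply/hasP; exists i; first by rewrite mem_iota.
rewrite codeC // (code_covers_map (c i) (x, y0) (x, y1) val_inj) code_coversE.
exact: cov.
Qed.

End Run.

Theorem theorem3 (R : realType) (k : nat) (k_gt0 : 0 < k) :
  decidable_in_time
    (fun n (G : sgraph 'I_n) => boxicity R (compl_graph (line_graph G)) <= k)
    (fun n => n ^ (5 * k + 4)).
Proof.
exists (cover_program k), (cover_time k), (cover_exponent k).
split=> [|n G s]; first exact: cover_time_bigO.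
have [s' [[run_s' le_s'] halt_s' reg_s']] := cover_program_reach G k.
have -> : s = s' by [].
split=> //.
- by move=> /found_correct; rewrite reg_s' => ->.
- by move=> nP; rewrite reg_s'; case: found (@found_correct _ G k R) => // -[/(_ isT)].
(* A halted configuration repeats forever, so the bound up to the time limit holds at all times. *)
move=> t a; have [/le_s'/(_ a)//|lt_t] := leqP t (cover_time k n).
rewrite -(subnKC (ltnW lt_t)) run_add run_s' run_halted //.
by rewrite -run_s'; exact: (le_s' _ (leqnn _) a).
Qed.
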